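(* Let $d$ be an allowed loop parameter with $d\ne3$, and $\omega\in\mathbb C^\times$ with $d=\omega+\omega^{-1}+1$. For any two complex numbers $z_0$ and $z_1$ satisfying $z_i\neq\pm\omega^n$ for all $n\in\mathbb Z$ ($i=0,1$), there are scale invariant transfer matrices $T(z_0,z_1)_t$ on $\mathcal H_{\mathcal Q,Y}$, that is, tensors $L_w\in Q_4$ for nonempty words $w$ on $\{0,1\}$ such that the operators $T(z_0,z_1)_t:=T^L_t$ on $\mathcal H_t$ satisfy $T^L_t\circ\iota_s^t=\iota_s^t\circ T^L_s$ for $s\le t$, such that on $\mathcal H_t=Q_2$, for $t$ the tree with two leaves, $T(z_0,z_1)_t$ is the transfer matrix $T(A(z_0),A(z_1))$ (so $L_0=A(z_0)$, $L_1=A(z_1)$). Moreover $L_{0w}$ is of the form $\kappa A(\varepsilon\omega^pz_0)$, where $\kappa\in\mathbb C$, $\varepsilon\in\{\pm1\}$ and $p\in\mathbb Z$ are all determined by $w$, and similarly for $L_{1w}$ (with $z_1$ in place of $z_0$).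
   Context: Allowed loop parameters: $d=4\cos^2(\pi/n)-1$ with $n=6,7,8,\dots$, or $d\in\mathbb R$, $d\ge3$. The planar algebra $\mathcal Q=(Q_n)$ (quantum $SO(3)$ in its 3-dimensional representation): $Q_n$ is the complex vector space spanned by planar trivalent graphs in a disc with $n$ boundary points, modulo the following local relations together with the radical of the sesquilinear form $\langle R,S\rangle$ obtained by gluing $R$ to the mirror image of $S$ and evaluating the resulting closed graph: a closed loop equals $d$; a vertex two of whose edges are joined to each other is $0$; a bigon equals a single strand; and $D-H=\frac1{d-1}(E-I)$, where, for a disc with boundary points $N,E,S,W$ in clockwise order, $H$ is the graph with two vertices joined by an edge, one attached to $N,W$ and the other to $E,S$; $D$ has two vertices joined by an edge, one attached to $N,E$ and the other to $S,W$; $I$ consists of arcs $N$–$E$ and $S$–$W$; $E$ (as a graph) consists of arcs $N$–$W$ and $E$–$S$. The form is positive definite for the allowed $d$, and $Q_1=0$. An element $pH+qI+rE$ of $Q_4$ is written $(p,q,r)$, and $$A(z)=\Big(-\frac{(1+\omega^2)(z+\omega^2)}{\omega^2(z+1)},\ 1,\ -\frac{(\omega-1)(z+\omega^2)}{\omega(\omega z-1)}\Big).$$ The direct system $\mathcal H_{\mathcal Q,Y}$: $\mathfrak T$ is the directed set of planar binary rooted trees, $s\le t$ iff $s$ is a rooted subtree of $t$; $\mathcal H_t=Q_k$ if $t$ has $k$ leaves (boundary points numbered clockwise $1,\dots,k$, corresponding to the leaves from left to right). If $t$ is obtained from $s$ by a binary branching at the $i$-th leaf, $\iota_s^t$ attaches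 a trivalent vertex to the $i$-th boundary point; general $\iota_s^t$ are compositions. For $L_1,\dots,L_k\in Q_4$, the transfer matrix $T(L_1,\dots,L_k):Q_k\to Q_k$ (periodic boundary conditions) sends $\xi$ to the diagram with $\xi$ in an inner disc, surrounded by $L_1,\dots,L_k$ placed clockwise, $S$ of $L_i$ joined to the $i$-th boundary point of $\xi$, $E$ of $L_i$ joined to $W$ of $L_{i+1}$ (indices mod $k$), and $N$ of $L_i$ being the $i$-th outer boundary point. Each leaf of a tree is coded by the word on $\{0,1\}$ read from root to leaf ($0$ left, $1$ right); if the leaves of $t$ have words $w_1,\dots,w_k$ from left to right, $T^L_t=T(L_{w_1},\dots,L_{w_k})$. For the one-leaf tree, $\mathcal H_t=Q_1=0$ and $T_t=0$. *)

(* Defs.v *)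
From HB Require Import structures.
From mathcomp Require Import all_boot all_order all_algebra generic_quotient.
From mathcomp Require Import finmap.
From mathcomp Require Import ring_quotient.
From mathcomp.multinomials Require Import monalg.
From mathcomp Require Import boolp reals trigo zify.

Set Implicit Arguments.
Unset Strict Implicit.
Unset Printing Implicit Defensive.

Import Order.TTheory GRing.Theory Num.Theory.
Local Open Scope ring_scope.

(** * Planar trivalent graphs

   A planar trivalent graph in a disc with n boundary points is drawn in
   generic position below a horizontal line, its boundary points lying on the
   line: read from left to right they are the points 1, ..., n in clockwise
   order.  Reading such a drawing upwards gives a word in elementary pieces;
   the piece (s, i) has i strands to its left.  Split and Merge are the two
   ways a trivalent vertex can point. *)

Variant shape := Cup | Cap | Split | Merge.

Definition ins s :=
  match s with Cup => 0 | Cap => 2 | Split => 1 | Merge => 2 end%N.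

Definition outs s :=
  match s with Cup => 2 | Cap => 0 | Split => 2 | Merge => 1 end%N.

Definition flip s :=
  match s with Cup => Cap | Cap => Cup | Split => Merge | Merge => Split end.

Definition shape_code s : 'I_4 :=
  match s with
  | Cup => inord 0 | Cap => inord 1 | Split => inord 2 | Merge => inord 3 end.

Definition shape_decode (k : 'I_4) :=
  match val k with 0 => Cup | 1 => Cap | 2 => Split | _ => Merge end%N.

Lemma shape_codeK : cancel shape_code shape_decode.
Proof. by case; rewrite /shape_decode /= inordK. Qed.

HB.instance Definition _ := Countable.copy shape (can_type shape_codeK).

Notation piece := (shape * nat)%type.
Notation word := {fmonom piece}.

Definition step (m : option nat) (a : piece) : option nat :=
  obind (fun k => if (a.2 + ins a.1 <= k)%N
                  then Some (k - ins a.1 + outs a.1)%N else None) m.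

Definition strands (m n : nat) (w : seq piece) :=
  foldl step (Some m) w == Some n.

(* [w] is a drawing in a disc with [n] boundary points. *)
Notation closes n w := (strands 0 n w).

Definition shift_piece (i : nat) (a : piece) : piece := (a.1, i + a.2)%N.
Definition shift_word (i : nat) (w : seq piece) := map (shift_piece i) w.

Lemma foldl_step_None w : foldl step None w = None.
Proof. by elim: w. Qed.

Lemma strands_shift m n i j w :
  strands m n w -> strands (i + (m + j)) (i + (n + j)) (shift_word i w).
Proof.
rewrite /strands; elim: w m => [|a w IHw] m /=; first by move=> /eqP[->].
case: ifP => am; last by rewrite foldl_step_None.
have -> : (i + a.2 + ins a.1 <= i + (m + j))%N by lia.
move=> /IHw; congr (foldl _ (Some _) _ == _); lia.
Qed.

(* The mirror image in the horizontal line. *)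
Definition mirror_word (w : seq piece) : seq piece :=
  rev [seq (flip a.1, a.2) | a : piece <- w].

(* Elementary planar isotopies: straightening of a strand, rotation of a
   vertex, and exchange of the heights of two pieces side by side. *)
Inductive isotopy : seq piece -> seq piece -> Prop :=
| isotopy_zigzagl i : isotopy [:: (Cup, i.+1); (Cap, i)] [::]
| isotopy_zigzagr i : isotopy [:: (Cup, i); (Cap, i.+1)] [::]
| isotopy_rotatel i : isotopy [:: (Merge, i)] [:: (Split, i.+1); (Cap, i)]
| isotopy_rotater i : isotopy [:: (Merge, i)] [:: (Split, i); (Cap, i.+1)]
| isotopy_exchange s i s' j :
    isotopy [:: (s, i); (s', i + outs s + j)%N]
            [:: (s', i + ins s + j)%N; (s, i)].

(* Boundary points of the four diagrams: N, E, S, W in this order. *)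
Definition wH : seq piece := [:: (Cup, 0); (Split, 0); (Split, 1)]%N.
Definition wD : seq piece := [:: (Cup, 0); (Split, 0); (Split, 2)]%N.
Definition wI : seq piece := [:: (Cup, 0); (Cup, 2)]%N.
Definition wE : seq piece := [:: (Cup, 0); (Cup, 1)]%N.

Lemma closes_HDIE : [&& closes 4 wH, closes 4 wD, closes 4 wI & closes 4 wE].
Proof. by []. Qed.

(** * The planar algebra *)

Section PlanarAlgebra.
Context {C : numClosedFieldType}.

(* Formal linear combinations of words; in a product [x * y], [y] is stacked on
   top of [x]. *)
Definition drawing := {malg C[word]}.
HB.instance Definition _ := GRing.Lalgebra.on drawing.

Definition draw (w : seq piece) : drawing := << FMonom w >>.

Definition shift (i : nat) (x : drawing) : drawing :=
  \sum_(w <- msupp x) x@_w *: draw (shift_word i w).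

Definition mirror (x : drawing) : drawing :=
  \sum_(w <- msupp x) (x@_w)^* *: draw (mirror_word w).

(* All the terms of [x] lead from [m] to [n] strands. *)
Definition strip (m n : nat) : {pred drawing} :=
  fun x => all (fun w : word => strands m n w) (msupp x).

Notation disc n := (strip 0 n).

Lemma strip_submod_closed m n : submod_closed (strip m n).
Proof.
split=> [|c x y /allP xn /allP yn]; first by apply/allP=> w; rewrite msupp0.
apply/allP=> w /(fsubsetP (msuppD_le _ _)); rewrite in_fsetU.
by case/orP=> [/(fsubsetP (msuppZ_le _ _))|]; [apply: xn | apply: yn].
Qed.

HB.instance Definition _ m n :=
  GRing.isSubmodClosed.Build C drawing (strip m n) (strip_submod_closed m n).

Lemma strip_draw m n w : strands m n w -> draw w \in strip m n.
Proof.
by move=> mnw; apply/allP=> u /(fsubsetP msuppU_le); rewrite in_fset1 => /eqP->.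
Qed.

Lemma stripM m k n x y : x \in strip m k -> y \in strip k n -> x * y \in strip m n.
Proof.
move=> /allP mx /allP ny; apply/allP=> w /msuppM_le[u [v [/mx /eqP mku /ny kn ->]]].
by rewrite /strands fmM foldl_cat mku.
Qed.

Lemma strip_shift m n x i j :
  x \in strip m n -> shift i x \in strip (i + (m + j)) (i + (n + j)).
Proof.
move=> /allP mx; rewrite /shift big_seq rpred_sum // => w /mx mnw.
by apply/rpredZ/strip_draw/strands_shift.
Qed.

(* The vector space spanned by the graphs with [n] boundary points. *)
Record graph_space (n : nat) :=
  GraphSpace { graph_val :> drawing; graph_valP : graph_val \in disc n }.

HB.instance Definition _ n := [isSub for @graph_val n].
HB.instance Definition _ n := [Choice of graph_space n by <:].
HB.instance Definition _ n :=
  [SubChoice_isSubLmodule of graph_space n by <:].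

Section Relations.
Variable d : C.

Inductive local_relation : drawing -> Prop :=
| relation_loop :
    local_relation (draw [:: (Cup, 0); (Cap, 0)]%N - d *: draw [::])
| relation_lollipop :
    local_relation (draw [:: (Cup, 0); (Merge, 0)]%N)
| relation_bigon :
    local_relation (draw [:: (Cup, 0); (Split, 0); (Merge, 0)]%N
                    - draw [:: (Cup, 0)]%N)
| relation_DH :
    local_relation (draw wD - draw wH
                    - (d - 1)^-1 *: (draw wE - draw wI)).

(* [skein n] is the span of the isotopies and of the local relations, applied
   inside graphs with [n] boundary points. *)
Inductive skein (n : nat) : drawing -> Prop :=
| skein_isotopy u a b v :
    isotopy a b -> closes n (u ++ a ++ v) -> closes n (u ++ b ++ v) ->
    skein n (draw (u ++ a ++ v) - draw (u ++ b ++ v))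
| skein_local u i x v :
    local_relation x -> draw u * shift i x * draw v \in disc n ->
    skein n (draw u * shift i x * draw v)
| skein_lin c x y : skein n x -> skein n y -> skein n (c *: x + y)
| skein0 : skein n 0.

(* The closed graph [x] has the value [c]: modulo the relations it is [c] times
   the empty graph. *)
Definition evaluates (x : drawing) (c : C) := skein 0 (x - c *: draw [::]).

(* The radical of the form <x, y>, the value of [x * mirror y]. *)
Definition radical (n : nat) (x : drawing) :=
  x \in disc n /\ forall y, y \in disc n -> evaluates (x * mirror y) 0.

(* The local relations together with the radical. *)
Definition null (n : nat) : {pred graph_space n} :=
  fun x => `[< exists2 y, skein n y & radical n (val x - y) >].
Arguments null : clear implicits.

Lemma null_submod_closed n : submod_closed (null n).
Proof.
split=> [|c x y /asboolP[x' sx [dx rx]] /asboolP[y' sy [dy ry]]].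
  apply/asboolP; exists 0; first exact: skein0.
  rewrite subrr; split=> [|y _]; first exact: rpred0.
  by rewrite /evaluates mul0r scale0r subrr; exact: skein0.
apply/asboolP; exists (c *: x' + y'); first exact: skein_lin.
have -> : val (c *: x + y) - (c *: x' + y') = c *: (val x - x') + (val y - y').
  by rewrite linearP scalerBr opprD addrACA.
split=> [|z dz]; first by rewrite rpredD ?rpredZ.
move: (skein_lin c (rx z dz) (ry z dz)).
by rewrite /evaluates !scale0r !subr0 scalerAl -mulrDl.
Qed.

HB.instance Definition _ n :=
  GRing.isSubmodClosed.Build C (graph_space n) (null n) (null_submod_closed n).

Definition Q (n : nat) : Type := Quotient.quot (null n).

HB.instance Definition _ n := ZmodQuotient.on (Q n).

Definition scaleQ n (c : C) (x : Q n) : Q n := \pi_(Q n)%qT (c *: repr x).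

Lemma scaleQ_pi n c (x : graph_space n) :
  scaleQ c (\pi_(Q n)%qT x) = \pi_(Q n)%qT (c *: x).
Proof.
apply/eqP; rewrite -Quotient.idealrBE -scalerBr rpredZ //.
by rewrite Quotient.idealrBE reprK.
Qed.

Lemma scaleQA n a b (x : Q n) : scaleQ a (scaleQ b x) = scaleQ (a * b) x.
Proof. by rewrite [scaleQ b x]/scaleQ scaleQ_pi scalerA. Qed.

Lemma scale1Q n : left_id 1 (@scaleQ n).
Proof. by move=> x; rewrite /scaleQ scale1r reprK. Qed.

Lemma scaleQDr n : right_distributive (@scaleQ n) +%R.
Proof.
move=> a x y; rewrite -{1}[x]reprK -{1}[y]reprK -raddfD.
by rewrite scaleQ_pi scalerDr raddfD.
Qed.

Lemma scaleQDl n (x : Q n) : {morph (@scaleQ n)^~ x : a b / a + b}.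
Proof. by move=> a b; rewrite /scaleQ scalerDl raddfD. Qed.

HB.instance Definition _ n := GRing.Zmodule_isLmodule.Build C (Q n)
  (@scaleQA n) (@scale1Q n) (@scaleQDr n) (@scaleQDl n).

(* Gluing operations on the spaces [Q n] are computed on the representatives
   [rep x]; [null] is stable under gluing. *)
Definition class n (x : drawing) : Q n := \pi_(Q n)%qT (insubd 0 x).

Definition rep n (x : Q n) : drawing := val (repr x).

Lemma repK n : cancel (@rep n) (@class n).
Proof. by move=> x; rewrite /class /rep valKd reprK. Qed.

Lemma rep_disc n (x : Q n) : rep x \in disc n.
Proof. exact: valP. Qed.

Definition elt4 (p q r : C) : Q 4 :=
  p *: class 4 (draw wH) + q *: class 4 (draw wI) + r *: class 4 (draw wE).

Definition A (omega z : C) : Q 4 :=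
  elt4 (- (((1 + omega ^+ 2) * (z + omega ^+ 2)) / (omega ^+ 2 * (z + 1))))
     1
     (- (((omega - 1) * (z + omega ^+ 2)) / (omega * (omega * z - 1)))).

(* A trivalent vertex attached to the boundary point number [i], counted from
   [0].  This is meaningful for [i < m] and [n = m.+1]. *)
Definition attach m n (i : nat) (xi : Q m) : Q n :=
  class n (rep xi * draw [:: (Split, i)]).

Lemma attach_disc m i (xi : Q m) : (i < m)%N ->
  rep xi * draw [:: (Split, i)] \in disc m.+1.
Proof.
move=> im; apply: stripM (rep_disc xi) (strip_draw _).
by rewrite /strands /= addn1 im subn1 addn2 prednK // (leq_trans _ im).
Qed.

(* [x] inserted with its points W and S joined to the strands [i] and [i.+1]. *)
Definition insert (i : nat) (x : drawing) : drawing :=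
  shift i x * draw [:: (Cap, i.+3); (Cap, i.+2)].

Lemma insert_strip i j x : x \in disc 4 ->
  insert i x \in strip (i + (2 + j)) (i + (2 + j)).
Proof.
move=> x4; apply: stripM (strip_shift i (2 + j) x4) (strip_draw _).
by rewrite /strands /= ifT /= ?ifT; [apply/eqP; congr Some|..]; lia.
Qed.

(* The strand created first, below [xi], joins W of the first tensor to E of
   the last one. *)
Definition transfer_drawing n (L : 'I_n -> drawing) (xi : drawing) : drawing :=
  draw [:: (Cup, 0%N)] * shift 1 xi * (\prod_(i < n) insert i (L i))
  * draw [:: (Cap, n)].

Lemma transfer_disc n (L : 'I_n -> drawing) xi :
  (forall i, L i \in disc 4) -> xi \in disc n ->
  transfer_drawing L xi \in disc n.
Proof.
move=> L4 xin.
have strip1 m : (1 : drawing) \in strip m m.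
  by apply/allP=> u /(fsubsetP msuppU_le); rewrite in_fset1 => /eqP->; rewrite /strands fm1.
apply: (@stripM _ (1 + (n + 1))); last first.
  by apply: strip_draw; rewrite /strands /= ifT; [apply/eqP; congr Some|]; lia.
apply: (@stripM _ (1 + (n + 1))).
  apply: (@stripM _ (1 + (0 + 1))); [exact: strip_draw | exact: strip_shift].
elim/big_ind: _ => [//|x y|i _]; first exact: stripM.
have -> : (1 + (n + 1) = i + (2 + (n - i)))%N by have := ltn_ord i; lia.
exact: insert_strip.
Qed.

Definition transfer n (L : 'I_n -> Q 4) (xi : Q n) : Q n :=
  class n (transfer_drawing (fun i => rep (L i)) (rep xi)).

End Relations.
End PlanarAlgebra.

Arguments elt4 {C} d p q r.
Arguments A {C} d omega z.

(** * Trees *)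

Inductive tree := Leaf | Node of tree & tree.

Fixpoint leaves t := if t is Node l r then (leaves l + leaves r)%N else 1%N.

(* The words of the leaves, from left to right; [false] is left. *)
Fixpoint codes t : seq (seq bool) :=
  if t is Node l r then map (cons false) (codes l) ++ map (cons true) (codes r)
  else [:: [::]].

Lemma size_codes t : size (codes t) = leaves t.
Proof. by elim: t => //= l <- r <-; rewrite size_cat !size_map. Qed.

(* [s] is a rooted subtree of [t]. *)
Fixpoint subtree s t :=
  match s, t with
  | Leaf, _ => true
  | Node l r, Node l' r' => subtree l l' && subtree r r'
  | Node _ _, Leaf => false
  end.

(* Binary branching at the leaf number [i], counted from [0]. *)
Fixpoint branch t i :=
  if t is Node l r then
    if (i < leaves l)%N then Node (branch l i) r
    else Node l (branch r (i - leaves l)%N)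
  else Node Leaf Leaf.

Lemma leaves_branch t i : (i < leaves t)%N -> leaves (branch t i) = (leaves t).+1.
Proof.
elim: t i => [|l IHl r IHr] i //= it.
by case: ifP => il /=; rewrite ?IHl ?IHr //; lia.
Qed.

Section DirectSystem.
Context {C : numClosedFieldType} (d : C).

Definition Hsys t : Type := Q d (leaves t).

(* The maps of the direct system: the compositions of elementary ones. *)
Inductive direct_map (s : tree) : forall t, (Hsys s -> Hsys t) -> Prop :=
| direct_map_id : direct_map (fun xi : Hsys s => xi)
| direct_map_branch t (f : Hsys s -> Hsys t) i :
    direct_map f -> (i < leaves t)%N ->
    direct_map (fun xi => attach (leaves (branch t i)) i (f xi) : Hsys (branch t i)).

Lemma subtreeP s t :
  subtree s t <-> exists f : Hsys s -> Hsys t, direct_map f.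
Proof.
split=> [|[f]]; last first.
  have refl u : subtree u u by elim: u => //= l -> r ->.
  have trans u v i : subtree u v -> subtree u (branch v i).
    elim: u v i => [|l IHl r IHr] [|l' r'] i //= /andP[ll rr].
    by case: ifP => _ /=; rewrite ?(IHl _ _ ll) ?(IHr _ _ rr) ?ll.
  by elim=> {t f} [|t f i _ IH _]; [exact: refl | exact: trans].
pose grows s t := exists f : Hsys s -> Hsys t, direct_map f.
have grows_id u : grows u u by exists (fun xi => xi); exact: direct_map_id.
have grows_branch u v i : grows u v -> (i < leaves v)%N -> grows u (branch v i).
  by move=> [f uv] iv; eexists; apply: direct_map_branch uv iv.
have grows_ind (P : tree -> tree) : (forall v i, (i < leaves v)%N ->
    exists2 j, (j < leaves (P v))%N & P (branch v i) = branch (P v) j) ->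
    forall u v, grows u v -> forall w, grows w (P u) -> grows w (P v).
  move=> PP u v [f]; elim=> {v f} [//|v f i _ IH iv w wu].
  by have [j jv ->] := PP v i iv; apply/grows_branch/jv/IH.
have grows_left r u v w : grows u v -> grows w (Node u r) -> grows w (Node v r).
  move=> uv; apply: (grows_ind (Node^~ r)) uv _ => v' i iv.
  by exists i => /=; rewrite ?iv // ltn_addr.
have grows_right l u v w : grows u v -> grows w (Node l u) -> grows w (Node l v).
  move=> uv; apply: (grows_ind (Node l)) uv _ => v' i iv.
  exists (leaves l + i)%N => /=; first by rewrite ltn_add2l.
  by rewrite ltnNge leq_addr /= addKn.
rewrite -/(grows s t); elim: s t => [|l IHl r IHr] [|l' r'] //=.
  move=> _; have leaf u : grows Leaf u.
    elim: u => [//|a IHa b IHb]; apply: (grows_right _ _ _ _ IHb).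
    by apply: (grows_left _ _ _ _ IHa); apply: (grows_branch _ Leaf 0%N).
  exact: leaf.
move=> /andP[/IHl ll /IHr rr].
by apply: (grows_right _ _ _ _ rr); apply: (grows_left _ _ _ _ ll).
Qed.

(* The value of [L] at the empty word is not used. *)
Definition Tsys (L : seq bool -> Q d 4) t : Hsys t -> Hsys t :=
  if t is Leaf then fun=> 0
  else transfer (fun i : 'I_(leaves t) => L (nth [::] (codes t) i)).

Definition scale_invariant (L : seq bool -> Q d 4) :=
  forall s t, subtree s t -> forall iota : Hsys s -> Hsys t, direct_map iota ->
  forall xi, Tsys L (iota xi) = iota (Tsys L xi).

End DirectSystem.

(** * Parameters *)

Definition allowed {R : realType} (d : R) :=
  (exists2 n : nat, (6 <= n)%N & d = 4 * cos (pi / n%:R) ^+ 2 - 1) \/ 3 <= d.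

Definition generic_spectral {C : numClosedFieldType} (omega z : C) :=
  forall n : int, z != omega ^ n /\ z != - omega ^ n.

(* Main.v *)
From HB Require Import structures.
From mathcomp Require Import all_boot all_order all_algebra generic_quotient.
From mathcomp.real_closed Require Import complex.
From mathcomp Require Import finmap.
From mathcomp.multinomials Require Import monalg.
From mathcomp Require Import boolp reals trigo zify ring.
Require Import Defs.

Set Implicit Arguments.
Unset Strict Implicit.
Unset Printing Implicit Defensive.

Import Order.TTheory GRing.Theory Num.Theory.
Local Open Scope ring_scope.

(** Scale invariance is a local property.  A transfer matrix commutes with the
   map that attaches a vertex to a boundary point as soon as, at the level of
   that point, the two tensors carried by the new leaves, fed by the vertex,
   equal the single tensor of the old leaf followed by the vertex: all other
   tensors slide past the vertex ([split_around], [transfer_attach]).  This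
   local condition is an identity between graphs with five boundary points.
   Modulo the skein relations every graph in it is a combination of one tree
   and of the five unions of an arc and a vertex; the relation between D and H
   compares the trees and removes triangles and squares.  Comparing the six
   coefficients leaves the polynomial system [intertwines]
   ([operator_split]), which is solved along the spectral curve: the tensor
   A(z) splits into A(- omega z) on the left and k A(- z / omega) on the right,
   with k = omega (z - omega) / (z - omega^3) ([intertwines_spectral]).  The
   parameters that occur are z times signed powers of omega, so that the
   genericity of z keeps all denominators away from 0, and the tensors of all
   words are obtained by recursion along the word.  That [d] is allowed excludes
   [d = 1], that is [1 + omega^2 = 0], where the relation between D and H would
   degenerate.

   Since [Q n] is a quotient by the radical of the form, while gluings are
   computed on representatives, the argument also needs that a drawing which
   vanishes in all closed graphs keeps this property inside every larger graph
   ([negligible_context]).  The form tests a drawing only against graphs that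
   lie above it, so a strand that passes below it has to be carried to the other
   side through the point at infinity ([eqw_sphere]).  This is allowed because a
   graph with two boundary points is a multiple of a strand
   ([disc2_scalar]).  That in turn follows from a normal form: words made of cups
   and splits span all graphs, because a cap or a merge that follows such a word
   can be pushed down until it disappears ([grown_shrink]), the relation between
   D and H being used when a merge meets half of a split.  No word of cups and
   splits has one boundary point, hence [Q 1 = 0], which settles the tree with
   one leaf; only the single cup has two. *)

Local Notation disc n := (strip 0 n).

(** * Words *)

Lemma strands_nil m n : strands m n [::] = (m == n).
Proof. by []. Qed.

Lemma strands_cons m n a w :
  strands m n (a :: w)
  = (a.2 + ins a.1 <= m)%N && strands (m - ins a.1 + outs a.1) n w.
Proof.
by rewrite /strands /=; case: ifP => //= _; rewrite foldl_step_None.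
Qed.

Lemma strands_cat m k n u v :
  strands m k u -> strands m n (u ++ v) = strands k n v.
Proof. by rewrite /strands foldl_cat => /eqP->. Qed.

Lemma strands_catW m k n u v :
  strands m k u -> strands k n v -> strands m n (u ++ v).
Proof. by move=> mk kn; rewrite (strands_cat _ _ mk). Qed.

Lemma strands_cat_inv m n u v :
  strands m n (u ++ v) -> exists2 k, strands m k u & strands k n v.
Proof.
rewrite /strands foldl_cat; case: (foldl step (Some m) u) => [k|] kn.
  by exists k.
by move: kn; rewrite foldl_step_None.
Qed.

Lemma shift_word_cat i u v : shift_word i (u ++ v) = shift_word i u ++ shift_word i v.
Proof. exact: map_cat. Qed.

Lemma shift_word0 w : shift_word 0 w = w.
Proof. by apply: map_id_in => -[s i] _. Qed.

Lemma shift_wordD i j w : shift_word i (shift_word j w) = shift_word (i + j) w.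
Proof. by rewrite /shift_word -map_comp; apply: eq_map => -[s k]; rewrite /= /shift_piece addnA. Qed.

Lemma strands_shiftr m n j w : strands m n w -> strands (m + j) (n + j) w.
Proof. by move=> /(strands_shift 0 j); rewrite shift_word0. Qed.

Lemma strands_shiftl m n i w :
  strands m n w -> strands (i + m) (i + n) (shift_word i w).
Proof. by move=> /(strands_shift i 0); rewrite !addn0. Qed.

Lemma flipK s : flip (flip s) = s. Proof. by case: s. Qed.
Lemma ins_flip s : ins (flip s) = outs s. Proof. by case: s. Qed.
Lemma outs_flip s : outs (flip s) = ins s. Proof. by case: s. Qed.

Lemma mirror_word_cat u v : mirror_word (u ++ v) = mirror_word v ++ mirror_word u.
Proof. by rewrite /mirror_word map_cat rev_cat. Qed.

Lemma mirror_wordK : involutive mirror_word.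
Proof.
move=> w; rewrite /mirror_word map_rev revK -map_comp.
by apply: map_id_in => -[s i] _ /=; rewrite flipK.
Qed.

Lemma strands_mirror m n w : strands m n w -> strands n m (mirror_word w).
Proof.
elim: w m => [|a w IHw] m; first by rewrite !strands_nil eq_sym.
rewrite strands_cons => /andP[am /IHw wm].
have -> : a :: w = [:: a] ++ w by [].
rewrite mirror_word_cat; apply: (strands_catW wm).
by rewrite /mirror_word /= strands_cons strands_nil /= ins_flip outs_flip; lia.
Qed.

Ltac strands :=
  rewrite /shift_word /= ?strands_cons ?strands_nil /=; lia.

(** * Linear combinations of words *)

Section Drawings.
Context {C : numClosedFieldType}.
Implicit Types (x y z : @drawing C) (u v w : seq piece).

Lemma draw_cat u v : draw (u ++ v) = draw u * draw v :> @drawing C.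
Proof.
rewrite /draw malgM_def /= fgmulUU mulr1; congr << _ *g _ >>.
by apply/eqP; rewrite fmP fmM.
Qed.

Lemma draw_nil : draw [::] = 1 :> @drawing C.
Proof. by rewrite /draw -fmoneE. Qed.

Lemma monalgUZ (K : monomType) (c : C) (k : K) :
  << c *g k >> = c *: << k >> :> {malg C[K]}.
Proof. by rewrite -mul_malgC malgM_def fgmulUU mul1m mulr1. Qed.

Lemma monalg_scaleUr (K : monomType) (c : C) (k : K) (y : {malg C[K]}) :
  c *: (<< k >> * y) = << k >> * (c *: y).
Proof.
rewrite -[c *: y]mul_malgC mulrA -mul_malgC mulrA; congr (_ * _).
by rewrite malgM_def fgmulUU malgM_def fgmulUU mul1m mulm1 mulr1 mul1r.
Qed.

Lemma draw_ind_supp (P : @drawing C -> Prop) x :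
  P 0 -> (forall c y z, P y -> P z -> P (c *: y + z)) ->
  (forall w : word, w \in msupp x -> P (draw w)) -> P x.
Proof.
move=> P0 PD Pw; rewrite [x]monalgE big_seq.
elim/big_ind: _ => // [a b Pa Pb|w wx]; first by rewrite -[a]scale1r; apply: PD.
rewrite monalgUZ -[X in P X]addr0; apply: PD => //.
by rewrite -(fmK w); apply: Pw.
Qed.

Lemma draw_ind (P : @drawing C -> Prop) m n :
  P 0 -> (forall c x y, P x -> P y -> P (c *: x + y)) ->
  (forall w, strands m n w -> P (draw w)) ->
  forall x, x \in strip m n -> P x.
Proof.
move=> P0 PD Pw x /allP xmn; apply: draw_ind_supp => // w wx.
by apply: Pw; apply: xmn.
Qed.

Lemma draw_indT (P : @drawing C -> Prop) :
  P 0 -> (forall c x y, P x -> P y -> P (c *: x + y)) ->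
  (forall w, P (draw w)) -> forall x, P x.
Proof. by move=> P0 PD Pw x; apply: draw_ind_supp. Qed.

Lemma strip_drawE m n w : (draw w \in @strip C m n) = strands m n w.
Proof.
apply/idP/idP => [/allP|]; last exact: strip_draw.
by move/(_ (FMonom w)); apply; rewrite /draw msuppU oner_eq0 in_fset1.
Qed.

Lemma scalerAr_draw c x y : c *: (x * y) = x * (c *: y).
Proof.
elim/draw_indT: x => [|a x1 x2 IH1 IH2|w]; first by rewrite !mul0r scaler0.
  by rewrite !mulrDl -!scalerAl scalerDr -IH1 -IH2 !scalerA [c * a]mulrC.
exact: monalg_scaleUr.
Qed.

End Drawings.

Section Extension.
Context {C : numClosedFieldType} (K : choiceType) (V : lmodType C).
Context (f : {rmorphism C -> C}) (h : K -> V).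

(** The map that is [h] on the basis and twisted by [f] on the scalars: [shift]
   is the case of the identity, [mirror] that of the conjugation. *)
Definition extend (x : {malg C[K]}) := \sum_(k <- msupp x) f x@_k *: h k.

Lemma extendEw (x : {malg C[K]}) (D : {fset K}) :
  (msupp x `<=` D)%fset -> extend x = \sum_(k <- D) f x@_k *: h k.
Proof.
move=> xD; rewrite /extend (big_fset_incl _ xD) // => k _ /mcoeff_outdom ->.
by rewrite rmorph0 scale0r.
Qed.

Lemma extend_semilinear c x y :
  extend (c *: x + y) = f c *: extend x + extend y.
Proof.
pose D := (msupp x `|` msupp y)%fset.
rewrite (@extendEw x D) ?fsubsetUl // (@extendEw y D) ?fsubsetUr //.
rewrite (@extendEw _ D); last first.
  apply: fsubset_trans (msuppD_le _ _) _.
  by apply: fsetSU; exact: msuppZ_le.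
rewrite scaler_sumr -big_split /=; apply: eq_bigr => k _.
by rewrite mcoeffD mcoeffZ rmorphD rmorphM scalerDl scalerA.
Qed.

Lemma extendU k : extend << k >> = h k.
Proof. by rewrite /extend msuppU oner_eq0 big_seq_fset1 mcoeffUU rmorph1 scale1r. Qed.

End Extension.

Section Shift.
Context {C : numClosedFieldType}.
Implicit Types (x y z : @drawing C) (u v w : seq piece).

Fact shift_linear i : linear (@shift C i).
Proof. exact: (@extend_semilinear C _ (@drawing C) idfun). Qed.

HB.instance Definition _ i :=
  GRing.isLinear.Build C (@drawing C) (@drawing C) *:%R (@shift C i) (shift_linear i).

Lemma shift_0 i : shift i 0 = 0 :> @drawing C. Proof. exact: linear0. Qed.
Lemma shiftB i x y : shift i (x - y) = shift i x - shift i y.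
Proof. exact: linearB. Qed.
Lemma shift_draw i w : shift i (draw w : @drawing C) = draw (shift_word i w).
Proof. exact: (@extendU C _ (@drawing C) idfun (fun w : word => draw (shift_word i w)) (FMonom w)). Qed.

Lemma shiftM i x y : shift i (x * y) = shift i x * shift i y.
Proof.
elim/(@draw_indT C): x => [|c x1 x2 IH1 IH2|u]; first by rewrite mul0r shift_0 mul0r.
  rewrite mulrDl -scalerAl (shift_linear i c x1 x2) (shift_linear i c) mulrDl -scalerAl.
  exact: (congr2 (fun a b => c *: a + b) IH1 IH2).
elim/(@draw_indT C): y => [|c x1 x2 IH1 IH2|v]; first by rewrite mulr0 shift_0 mulr0.
  rewrite mulrDr -scalerAr_draw (shift_linear i c x1 x2) (shift_linear i c) mulrDr.
  rewrite -scalerAr_draw; exact: (congr2 (fun a b => c *: a + b) IH1 IH2).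
by rewrite -draw_cat !shift_draw shift_word_cat draw_cat.
Qed.

Lemma shift0 x : shift 0 x = x.
Proof.
elim/(@draw_indT C): x => [|c x1 x2 IH1 IH2|u]; first by rewrite shift_0.
  by rewrite shift_linear IH1 IH2.
by rewrite shift_draw shift_word0.
Qed.

Lemma shiftD i j x : shift i (shift j x) = shift (i + j) x.
Proof.
elim/(@draw_indT C): x => [|c x1 x2 IH1 IH2|u]; first by rewrite !shift_0.
  rewrite (shift_linear j c x1 x2) (shift_linear i c) (shift_linear (i + j) c).
  exact: (congr2 (fun a b => c *: a + b) IH1 IH2).
by rewrite !shift_draw shift_wordD.
Qed.

Fact mirror_semilinear c x y : mirror (c *: x + y) = c^* *: mirror x + mirror y.
Proof. exact: (@extend_semilinear C _ (@drawing C) Num.conj). Qed.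

Lemma mirror_draw w : mirror (draw w : @drawing C) = draw (mirror_word w).
Proof. exact: (@extendU C _ (@drawing C) Num.conj (fun w : word => draw (mirror_word w)) (FMonom w)). Qed.

Lemma mirror0 : mirror 0 = 0 :> @drawing C.
Proof. by rewrite -[0 in LHS](subrr 0) -scaleN1r addrC mirror_semilinear rmorphN1 scaleN1r addNr. Qed.

Lemma strip_mulr m k n x w :
  x \in strip m k -> strands k n w -> x * draw w \in strip m n.
Proof. by move=> xs ws; apply: stripM xs (strip_draw ws). Qed.

Lemma strip_mull m k n x w :
  strands m k w -> x \in strip k n -> draw w * x \in strip m n.
Proof. by move=> ws xs; apply: stripM (strip_draw ws) xs. Qed.

Lemma strip1 m : 1 \in @strip C m m.
Proof. by rewrite -draw_nil strip_drawE strands_nil. Qed.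

End Shift.

(** * Equality modulo the skein relations *)

Section Skein.
Context {C : numClosedFieldType} (d : C).
Implicit Types (x y z : @drawing C) (u v w a b : seq piece).

Lemma skeinD n x y : skein d n x -> skein d n y -> skein d n (x + y).
Proof. by move=> sx sy; rewrite -[x]scale1r; exact: skein_lin. Qed.

Lemma drawing_mulrBr x y z : x * (y - z : @drawing C) = (x * y : @drawing C) - (x * z : @drawing C) :> @drawing C.
Proof. exact: mulrBr. Qed.

Lemma drawing_mulrBl x y z : (x - y : @drawing C) * z = (x * z : @drawing C) - (y * z : @drawing C) :> @drawing C.
Proof. exact: mulrBl. Qed.

Lemma shift_lin i c x y :
  shift i (c *: x + y : @drawing C) = c *: (shift i x : @drawing C) + (shift i y : @drawing C) :> @drawing C.
Proof. exact: shift_linear. Qed.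

Lemma drawing_linl c x y z :
  (c *: x + y : @drawing C) * z = c *: (x * z : @drawing C) + (y * z : @drawing C) :> @drawing C.
Proof. by rewrite mulrDl -scalerAl. Qed.

Lemma drawing_linr c x y z :
  z * (c *: x + y : @drawing C) = c *: (z * x : @drawing C) + (z * y : @drawing C) :> @drawing C.
Proof. by rewrite mulrDr -scalerAr_draw. Qed.

Lemma drawing_mulr0 x : x * (0 : @drawing C) = (0 : @drawing C) :> @drawing C.
Proof. exact: mulr0. Qed.
Lemma drawing_mul0r x : (0 : @drawing C) * x = (0 : @drawing C) :> @drawing C.
Proof. exact: mul0r. Qed.
Lemma sandwich0 i u v : draw u * shift i 0 * draw v = 0 :> @drawing C.
Proof. by rewrite -> shift_0, drawing_mulr0, drawing_mul0r. Qed.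

Lemma sandwich_linear i u v c x y : draw u * shift i (c *: x + y) * draw v
  = c *: (draw u * shift i x * draw v : @drawing C) + (draw u * shift i y * draw v : @drawing C).
Proof. by rewrite -> shift_lin, drawing_linr, drawing_linl. Qed.

Lemma sandwichB i u v x y : draw u * shift i (x - y : @drawing C) * draw v
  = (draw u * shift i x * draw v : @drawing C) - (draw u * shift i y * draw v : @drawing C) :> @drawing C.
Proof. by rewrite -> shiftB, drawing_mulrBr, drawing_mulrBl. Qed.

Lemma sandwich_draw i u v w : draw u * shift i (draw w) * draw v
  = draw (u ++ shift_word i w ++ v) :> @drawing C.
Proof. by rewrite -> shift_draw, !draw_cat, mulrA. Qed.

Lemma shift_sandwich i u x v : shift i (draw u * x * draw v)
  = draw (shift_word i u) * shift i x * draw (shift_word i v).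
Proof. by rewrite -> !shiftM, !shift_draw. Qed.

Lemma sandwich_cat u u' x v v' :
  draw u * (draw u' * x * draw v') * draw v = draw (u ++ u') * x * draw (v' ++ v).
Proof. by rewrite -> 2!draw_cat, !mulrA. Qed.

Lemma skein_disc n x : skein d n x -> x \in disc n.
Proof.
elim=> {x} [u a b v _ ua ub|//|c x y _ xn _ yn|]; last exact: rpred0.
  by apply: rpredB; exact: strip_draw.
by apply: rpredD => //; apply: rpredZ.
Qed.

Lemma isotopy_shift k a b : isotopy a b -> isotopy (shift_word k a) (shift_word k b).
Proof.
case=> [i|i|i|i|s i s' j] /=; rewrite /shift_piece /= ?addnS.
- exact: isotopy_zigzagl.
- exact: isotopy_zigzagr.
- exact: isotopy_rotatel.
- exact: isotopy_rotater.
- by rewrite !addnA; exact: isotopy_exchange.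
Qed.

(** Each generator of [skein n] is already a relation inside a graph, so that
   enlarging the graph only enlarges the prefix and the suffix of the words. *)
Lemma skein_context n x : skein d n x -> forall i j k u v,
  closes (i + j) u -> strands (i + (n + j)) k v ->
  skein d k (draw u * shift i x * draw v).
Proof.
elim=> {x} [u0 a b v0 ab a0 b0|u0 l x v0 lx x0|c x y _ IHx _ IHy|] i j k u v uij vij.
- have cl c : closes n (u0 ++ c ++ v0) ->
      closes k ((u ++ shift_word i u0) ++ shift_word i c ++ shift_word i v0 ++ v).
    move=> /(strands_shift i j) c0; rewrite 2!catA; apply: strands_catW vij.
    by rewrite -!catA; apply: strands_catW uij _; rewrite -!shift_word_cat.
  have -> : draw u * shift i (draw (u0 ++ a ++ v0) - draw (u0 ++ b ++ v0)) * draw v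
     = draw ((u ++ shift_word i u0) ++ shift_word i a ++ shift_word i v0 ++ v)
     - draw ((u ++ shift_word i u0) ++ shift_word i b ++ shift_word i v0 ++ v) :> @drawing C.
    rewrite -> sandwichB, !sandwich_draw.
    by rewrite !shift_word_cat -!catA.
  by apply: skein_isotopy; [exact: isotopy_shift | exact: cl | exact: cl].
- have -> : draw u * shift i (draw u0 * shift l x * draw v0) * draw v
     = draw (u ++ shift_word i u0) * shift (i + l) x * draw (shift_word i v0 ++ v).
    by rewrite -> shift_sandwich, shiftD, sandwich_cat.
  apply: skein_local => //.
  have -> : draw (u ++ shift_word i u0) * shift (i + l) x * draw (shift_word i v0 ++ v)
     = draw u * shift i (draw u0 * shift l x * draw v0) * draw v.
    by rewrite -> shift_sandwich, shiftD, sandwich_cat.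
  apply: strip_mulr vij; apply: strip_mull uij _.
  exact: (strip_shift i j x0).
- rewrite -> sandwich_linear.
  by apply: skein_lin; [exact: (IHx _ j) | exact: (IHy _ j)].
by rewrite -> sandwich0; exact: skein0.
Qed.

(** [skein] speaks of discs only.  Drawings in a strip are compared in all the
   graphs that contain the strip, which makes the relation stable under
   composition and under juxtaposition. *)
Definition eqv m n x y :=
  [/\ x \in strip m n, y \in strip m n & forall i j k u v,
      closes (i + (m + j)) u -> strands (i + (n + j)) k v ->
      skein d k (draw u * shift i (x - y : @drawing C) * draw v)].

Lemma eqv_refl m n x : x \in strip m n -> eqv m n x x.
Proof.
move=> xs; split=> [||i j k u v _ _]; [by [] | by [] |].
by rewrite subrr; rewrite -> sandwich0; exact: skein0.
Qed.

Lemma eqv_sym m n x y : eqv m n x y -> eqv m n y x.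
Proof.
case=> xs ys xy; split=> [||i j k u v ui vi]; [by [] | by [] |].
have -> : y - x = (- 1) *: (x - y) + 0 by rewrite addr0 scaleN1r opprB.
rewrite -> sandwich_linear, sandwich0.
by apply: skein_lin; [apply: xy vi | exact: skein0].
Qed.

Lemma eqv_trans y m n x z : eqv m n x y -> eqv m n y z -> eqv m n x z.
Proof.
case=> xs ys xy [_ zs yz]; split=> [||i j k u v ui vi]; [by [] | by [] |].
have -> : x - z = 1 *: (x - y) + (y - z) by rewrite scale1r addrA subrK.
rewrite -> sandwich_linear.
by apply: skein_lin; [apply: xy vi | apply: yz vi].
Qed.

Lemma eqv_lin m n c x y x' y' : eqv m n x x' -> eqv m n y y' ->
  eqv m n (c *: x + y) (c *: x' + y').
Proof.
case=> xs x's xx [ys y's yy]; split=> [||i j k u v ui vi].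
- by apply: rpredD => //; apply: rpredZ.
- by apply: rpredD => //; apply: rpredZ.
have -> : c *: x + y - (c *: x' + y') = c *: (x - x') + (y - y').
  by rewrite scalerBr opprD addrACA.
rewrite -> sandwich_linear.
by apply: skein_lin; [apply: xx vi | apply: yy vi].
Qed.

Lemma eqv_drawl m k n x y w :
  eqv k n x y -> strands m k w -> eqv m n (draw w * x) (draw w * y).
Proof.
case=> xs ys xy mw; split=> [||i j l u v ui vi]; try exact: strip_mull mw _.
rewrite <- drawing_mulrBr.
rewrite -> shiftM, mulrA, shift_draw, <- draw_cat.
by apply: xy vi; apply: strands_catW ui _; exact: strands_shift.
Qed.

Lemma eqv_drawr m k n x y w :
  eqv m k x y -> strands k n w -> eqv m n (x * draw w) (y * draw w).
Proof.
case=> xs ys xy mw; split=> [||i j l u v ui vi]; try by apply: strip_mulr mw.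
rewrite -mulrBl shiftM -!mulrA shift_draw -draw_cat mulrA.
by apply: (xy _ _ _ _ _ ui); apply: strands_catW vi; exact: strands_shift.
Qed.

Lemma eqv_mul m k n x x' y y' : eqv m k x x' -> eqv k n y y' ->
  eqv m n (x * y) (x' * y').
Proof.
move=> xx yy; have [xs x's _] := xx; have [ys y's _] := yy.
apply: (@eqv_trans (x * y')).
  elim/(@draw_ind C): xs {xx} => [|c x1 x2 IH1 IH2|w wm].
  - by rewrite -> !drawing_mul0r; apply/eqv_refl/rpred0.
  - rewrite -> 2!drawing_linl; exact: eqv_lin.
  exact: eqv_drawl wm.
elim/(@draw_ind C): y's {yy} => [|c x1 x2 IH1 IH2|w wm].
- by rewrite -> !drawing_mulr0; apply/eqv_refl/rpred0.
- rewrite -> 2!drawing_linr; exact: eqv_lin.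
exact: eqv_drawr wm.
Qed.

Lemma eqv_shift i j m n x y :
  eqv m n x y -> eqv (i + (m + j)) (i + (n + j)) (shift i x) (shift i y).
Proof.
case=> xs ys xy; split=> [||i' j' k u v ui vi]; try exact: strip_shift.
rewrite <- shiftB; rewrite -> shiftD.
by apply: (xy _ (j + j')%N); [move: ui | move: vi]; congr (strands _ _ _); lia.
Qed.

Lemma eqv_skein n x y : eqv 0 n x y -> skein d n (x - y).
Proof.
case=> _ _ /(_ 0 0 n [::] [::])%N.
rewrite draw_nil mul1r mulr1 shift0 !addn0 !add0n; apply; exact: eqxx.
Qed.

Lemma skein_eqv n x y : skein d n (x - y) -> y \in disc n -> eqv 0 n x y.
Proof.
move=> sxy yn; split=> // [|i j k u v ui vi].
  by rewrite -[x](subrK y); apply: rpredD => //; exact: skein_disc.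
exact: skein_context sxy _ _ _ _ _ ui vi.
Qed.

Definition eqw m n a b := eqv m n (draw a) (draw b).

Lemma eqw_refl m n a : strands m n a -> eqw m n a a.
Proof. by move=> am; apply/eqv_refl/strip_draw. Qed.

Lemma eqw_sym m n a b : eqw m n a b -> eqw m n b a.
Proof. exact: eqv_sym. Qed.

Lemma eqw_trans b m n a c : eqw m n a b -> eqw m n b c -> eqw m n a c.
Proof. exact: eqv_trans. Qed.

Lemma eqw_cat m k n a a' b b' :
  eqw m k a a' -> eqw k n b b' -> eqw m n (a ++ b) (a' ++ b').
Proof. by rewrite /eqw !draw_cat; exact: eqv_mul. Qed.

Lemma eqw_catl m k n u a b :
  strands m k u -> eqw k n a b -> eqw m n (u ++ a) (u ++ b).
Proof. by move=> /eqw_refl; exact: eqw_cat. Qed.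

Lemma eqw_catr m k n v a b :
  eqw m k a b -> strands k n v -> eqw m n (a ++ v) (b ++ v).
Proof. by move=> ab /eqw_refl; exact: eqw_cat. Qed.

Lemma eqw_shift i j m n a b : eqw m n a b ->
  eqw (i + (m + j)) (i + (n + j)) (shift_word i a) (shift_word i b).
Proof. by rewrite /eqw -!shift_draw; exact: eqv_shift. Qed.

Lemma eqw_isotopy m n a b :
  isotopy a b -> strands m n a -> strands m n b -> eqw m n a b.
Proof.
move=> ab am bm; split; [exact: strip_draw | exact: strip_draw |].
move=> i j k u v ui vi; rewrite -> sandwichB, !sandwich_draw.
apply: skein_isotopy; first exact: isotopy_shift.
- by apply: strands_catW ui _; apply: strands_catW vi; exact: strands_shift.
- by apply: strands_catW ui _; apply: strands_catW vi; exact: strands_shift.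
Qed.

Lemma eqv_local x y i m n :
  local_relation d (x - y) ->
  shift i x \in strip m n -> shift i y \in strip m n ->
  eqv m n (shift i x) (shift i y).
Proof.
move=> xy xs ys; split=> [||k j l u v uk vk]; [by [] | by [] |].
rewrite <- shiftB; rewrite -> shiftD.
apply: skein_local => //; rewrite <- shiftD.
apply: strip_mulr vk; apply: strip_mull uk _; apply: strip_shift.
rewrite -> shiftB; exact: (rpredB xs ys).
Qed.

End Skein.

(** * Exchanging graphs side by side *)

Section Isotopies.
Context {C : numClosedFieldType} (d : C).
Implicit Types (x y z : @drawing C) (u v w a b : seq piece).

Lemma eqw_far0 m k p r s i s' j : strands m k [:: (s, i)] -> strands p r [:: (s', j)] ->
  eqw d (m + p) (k + r) [:: (s, i); (s', k + j)%N] [:: (s', m + j)%N; (s, i)].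
Proof.
move=> mk pr; have := mk; have := pr; rewrite !strands_cons !strands_nil /= => {}pr {}mk.
have -> : (k + j = i + outs s + (m - ins s - i + j))%N by lia.
have -> : (m + j = i + ins s + (m - ins s - i + j))%N by lia.
by apply: eqw_isotopy; [exact: isotopy_exchange | |]; strands.
Qed.

Lemma eqw_far1 m k p q c b : strands m k [:: c] -> strands p q b ->
  eqw d (m + p) (k + q) (c :: shift_word k b) (shift_word m b ++ [:: c]).
Proof.
move=> mk; elim: b p => [|e b IHb] p pq.
  by move: pq; rewrite strands_nil => /eqP->; exact/eqw_refl/strands_shiftr.
have [r pr rq] := strands_cat_inv (pq : strands p q ([:: e] ++ b)).
apply: (@eqw_trans _ _ (shift_word m [:: e] ++ [:: c] ++ shift_word k b)).
  apply: (@eqw_catr _ _ _ (k + r) _ _ [:: c; shift_piece k e] [:: shift_piece m e; c]).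
    by case: c e mk pr {IHb pq} => [s i] [s' j] mk pr; exact: eqw_far0.
  exact: strands_shiftl.
apply: (@eqw_catl _ _ _ (m + r) _ (shift_word m [:: e]) ([:: c] ++ shift_word k b)).
  exact: strands_shiftl.
exact: IHb.
Qed.

(** The height exchange of two pieces, iterated over both words: [a] occupies
   the [m] strands on the left, [b] the [p] strands on its right. *)
Lemma eqw_far m n p q a b : strands m n a -> strands p q b ->
  eqw d (m + p) (n + q) (a ++ shift_word n b) (shift_word m b ++ a).
Proof.
move=> mn pq; elim: a m mn => [|c a IHa] m mn.
  move: mn; rewrite strands_nil => /eqP->; rewrite cats0.
  exact/eqw_refl/strands_shiftl.
have [k mk kn] := strands_cat_inv (mn : strands m n ([:: c] ++ a)).
apply: (@eqw_trans _ _ ([:: c] ++ shift_word k b ++ a)).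
  apply: (@eqw_catl _ _ _ (k + p) _ [:: c]); last exact: IHa.
  exact: strands_shiftr.
rewrite -[c :: a]/([:: c] ++ a) !catA.
apply: eqw_catr; last exact: strands_shiftr kn.
exact: eqw_far1.
Qed.

Lemma eqv_far m n p q x y : x \in strip m n -> y \in strip p q ->
  eqv d (m + p) (n + q) (x * shift n y) (shift m y * x).
Proof.
move=> xs ys; elim/(@draw_ind C): xs => [|c x1 x2 IH1 IH2|a am].
- by rewrite -> drawing_mul0r, drawing_mulr0; apply/eqv_refl/rpred0.
- rewrite -> drawing_linl, drawing_linr; exact: eqv_lin.
elim/(@draw_ind C): ys => [|c x1 x2 IH1 IH2|b bm].
- by rewrite -> !shift_0, drawing_mul0r, drawing_mulr0; apply/eqv_refl/rpred0.
- rewrite -> !shift_lin, drawing_linl, drawing_linr.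
  exact: eqv_lin.
by rewrite -> !shift_draw, <- !draw_cat; exact: eqw_far.
Qed.

(** Both sides of an isotopy have the same effect on the number of strands, so
   that one typing of the surroundings serves for both. *)
Lemma eqw_step m n u a b v : isotopy a b ->
  strands m n (u ++ a ++ v) -> strands m n (u ++ b ++ v) ->
  eqw d m n (u ++ a ++ v) (u ++ b ++ v).
Proof.
move=> ab /strands_cat_inv[k mk /strands_cat_inv[l kl ln]].
rewrite (strands_cat _ _ mk) => /strands_cat_inv[l' kl' ln'].
have ll' : l = l'.
  move: kl kl' ln ln'; rewrite /strands => /eqP kl /eqP kl'.
  suff : foldl step (Some k) a = foldl step (Some k) b.
    by rewrite kl kl' => -[->].
  move: ab kl kl' {u v mk}; case=> [i|i|i|i|s i s' j]; rewrite /step /=;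
    do !case: ifP => //=; intros; congr Some; lia.
subst l'; apply: eqw_catl mk _; apply: eqw_catr ln.
exact: eqw_isotopy.
Qed.
End Isotopies.

(* [move_step u r v] closes an equivalence of explicit words by the isotopy [r]
   between the words [u] and [v]; [back_step] uses [r] from right to left. *)
Ltac move_step u r v := apply: (@eqw_step _ _ _ _ u _ _ v r); exact: isT.
Ltac back_step u r v :=
  apply: eqw_sym; move_step u r v.

(** * Local relations as operators on strands *)

Section Combinations.
Context {C : numClosedFieldType} (d : C).
Local Open Scope ring_scope.
Implicit Types (s t : seq (C * seq piece)) (u v w a b : seq piece).

Definition comb s : @drawing C := foldr (fun p x => p.1 *: draw p.2 + x) 0 s.

Lemma comb_cons c a s : comb ((c, a) :: s) = c *: draw a + comb s.
Proof. by []. Qed.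

Lemma comb_cat s t : comb (s ++ t) = comb s + comb t.
Proof. by elim: s => [|[c a] s IHs]; rewrite ?add0r //= IHs addrA. Qed.

Lemma comb_scale c s : comb [seq (c * p.1, p.2) | p <- s] = c *: comb s.
Proof.
elim: s => [|[e a] s IHs]; first by rewrite scaler0.
by rewrite map_cons !comb_cons IHs scalerDr scalerA.
Qed.

Lemma comb_drawr w s : comb s * draw w = comb [seq (p.1, p.2 ++ w) | p <- s].
Proof.
elim: s => [|[e a] s IHs]; first exact: drawing_mul0r.
rewrite map_cons !comb_cons -IHs [draw (a ++ w)]draw_cat; exact: drawing_linl.
Qed.

Lemma comb_drawl w s : draw w * comb s = comb [seq (p.1, w ++ p.2) | p <- s].
Proof.
elim: s => [|[e a] s IHs]; first exact: drawing_mulr0.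
rewrite map_cons !comb_cons -IHs [draw (w ++ a)]draw_cat; exact: drawing_linr.
Qed.

Lemma comb_shift i s : shift i (comb s) = comb [seq (p.1, shift_word i p.2) | p <- s].
Proof.
elim: s => [|[e a] s IHs]; first exact: shift_0.
rewrite map_cons !comb_cons -IHs -[draw (shift_word i a)]shift_draw; exact: shift_lin.
Qed.

Lemma strip_comb m n s : all (fun p => strands m n p.2) s -> comb s \in strip m n.
Proof.
elim: s => [|[e a] s IHs] /=; first by move=> _; exact: rpred0.
case/andP=> am sm; apply: rpredD; last exact: IHs.
by apply: rpredZ; rewrite strip_drawE.
Qed.

Lemma eqv_comb0 m n : eqv d m n (comb [::]) (comb [::]).
Proof. by apply/eqv_refl/rpred0. Qed.

Lemma eqv_comb m n c a b s t : eqw d m n a b -> eqv d m n (comb s) (comb t) ->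
  eqv d m n (comb ((c, a) :: s)) (comb ((c, b) :: t)).
Proof. exact: eqv_lin. Qed.

End Combinations.

Section Local.
Local Open Scope nat_scope.
Context {C : numClosedFieldType} (d : C).
Implicit Types (x y z : @drawing C) (u v w a b : seq piece).

(* A split is a merge one of whose legs is bent down, on either side. *)
Lemma split_cupl : eqw d 1 2 [:: (Cup, 1); (Merge, 0)] [:: (Split, 0)].
Proof.
apply: (@eqw_trans _ _ [:: (Cup, 1); (Split, 0); (Cap, 1)]).
  move_step [:: (Cup, 1)] (isotopy_rotater 0) ([::] : seq piece).
apply: (@eqw_trans _ _ [:: (Split, 0); (Cup, 2); (Cap, 1)]).
  back_step ([::] : seq piece) (isotopy_exchange Split 0 Cup 0) [:: (Cap, 1)].
move_step [:: (Split, 0)] (isotopy_zigzagl 1) ([::] : seq piece).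
Qed.

Lemma split_cupr : eqw d 1 2 [:: (Cup, 0); (Merge, 1)] [:: (Split, 0)].
Proof.
apply: (@eqw_trans _ _ [:: (Cup, 0); (Split, 2); (Cap, 1)]).
  move_step [:: (Cup, 0)] (isotopy_rotatel 1) ([::] : seq piece).
apply: (@eqw_trans _ _ [:: (Split, 0); (Cup, 0); (Cap, 1)]).
  move_step ([::] : seq piece) (isotopy_exchange Cup 0 Split 0) [:: (Cap, 1)].
move_step [:: (Split, 0)] (isotopy_zigzagr 0) ([::] : seq piece).
Qed.

Lemma merge_capr : eqw d 2 1 [:: (Split, 0); (Cap, 1)] [:: (Merge, 0)].
Proof. back_step ([::] : seq piece) (isotopy_rotater 0) ([::] : seq piece). Qed.

Lemma merge_capl : eqw d 2 1 [:: (Split, 1); (Cap, 0)] [:: (Merge, 0)].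
Proof. back_step ([::] : seq piece) (isotopy_rotatel 0) ([::] : seq piece). Qed.

Lemma loop_value : eqv d 0 0 (draw [:: (Cup, 0); (Cap, 0)]) (comb [:: (d, [::])]).
Proof.
rewrite /comb /= addr0 -[X in eqv _ _ _ X _]shift0 -[X in eqv _ _ _ _ X]shift0.
apply: eqv_local; first exact: relation_loop.
  by rewrite shift0 strip_drawE.
by rewrite shift0; apply: rpredZ; rewrite strip_drawE.
Qed.

Lemma lollipop_merge : eqv d 0 1 (draw [:: (Cup, 0); (Merge, 0)]) 0%R.
Proof.
rewrite -[X in eqv _ _ _ X _]shift0 -[X in eqv _ _ _ _ X]shift0.
apply: eqv_local; first by rewrite subr0; exact: relation_lollipop.
  by rewrite shift0 strip_drawE.
by rewrite shift0; exact: rpred0.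
Qed.

(** The lollipop of the relations has its stem on top.  Here the stem comes from
   below: it is bent upwards and the vertex is rotated accordingly. *)
Lemma lollipop_cap : eqv d 1 0 (draw [:: (Split, 0); (Cap, 0)]) 0%R.
Proof.
apply: (@eqv_trans _ _ (draw ([:: (Cup, 1); (Merge, 1)] ++ [:: (Cap, 0)]))).
  apply: (@eqw_trans _ _ [:: (Cup, 1); (Merge, 0); (Cap, 0)]).
    apply: eqw_sym; exact: (@eqw_catr _ _ _ _ _ [:: (Cap, 0)] _ _ split_cupl).
  apply: (@eqw_trans _ _ [:: (Cup, 1); (Split, 1); (Cap, 0); (Cap, 0)]).
    move_step [:: (Cup, 1)] (isotopy_rotatel 0) [:: (Cap, 0)].
  apply: (@eqw_trans _ _ [:: (Cup, 1); (Split, 1); (Cap, 2); (Cap, 0)]).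
    move_step [:: (Cup, 1); (Split, 1)] (isotopy_exchange Cap 0 Cap 0) ([::] : seq piece).
  back_step [:: (Cup, 1)] (isotopy_rotater 1) [:: (Cap, 0)].
have := eqv_drawr (eqv_shift 1 0 lollipop_merge) (isT : strands 2 0 [:: (Cap, 0)]).
by rewrite -> shift_0, drawing_mul0r, shift_draw, <- draw_cat.
Qed.

Lemma bigon_cup : eqw d 0 2 [:: (Cup, 0); (Split, 0); (Merge, 0)] [:: (Cup, 0)].
Proof.
rewrite /eqw -[X in eqv _ _ _ X _]shift0 -[X in eqv _ _ _ _ X]shift0.
apply: eqv_local; first exact: relation_bigon.
  by rewrite shift0 strip_drawE.
by rewrite shift0 strip_drawE.
Qed.

(** The given relation has the strand of the bigon closed by a cup; a zigzag on
   that strand provides the cup. *)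
Lemma bigon_value : eqw d 1 1 [:: (Split, 0); (Merge, 0)] [::].
Proof.
apply: (@eqw_trans _ _ [:: (Cup, 0); (Cap, 1); (Split, 0); (Merge, 0)]).
  back_step ([::] : seq piece) (isotopy_zigzagr 0) [:: (Split, 0); (Merge, 0)].
apply: (@eqw_trans _ _ [:: (Cup, 0); (Split, 0); (Cap, 2); (Merge, 0)]).
  back_step [:: (Cup, 0)] (isotopy_exchange Split 0 Cap 0) [:: (Merge, 0)].
apply: (@eqw_trans _ _ [:: (Cup, 0); (Split, 0); (Merge, 0); (Cap, 1)]).
  back_step [:: (Cup, 0); (Split, 0)] (isotopy_exchange Merge 0 Cap 0) ([::] : seq piece).
apply: (@eqw_trans _ _ [:: (Cup, 0); (Cap, 1)]).
  have := eqw_shift 0 1 bigon_cup; rewrite !shift_word0 => cup.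
  exact: (@eqw_catr _ _ _ _ _ [:: (Cap, 1)] _ _ cup).
move_step ([::] : seq piece) (isotopy_zigzagr 0) ([::] : seq piece).
Qed.

(** Turning the points W and S down makes an operator on two strands of a graph
   with four boundary points; it is the form in which a transfer matrix uses its
   tensors. *)
Definition turn := [:: (Cap, 3); (Cap, 2)].

Lemma turn_H : eqw d 2 2 (wH ++ turn) [:: (Split, 0); (Merge, 1)].
Proof.
apply: (@eqw_trans _ _ [:: (Cup, 0); (Split, 0); (Cap, 2); (Split, 1); (Cap, 2)]).
  move_step [:: (Cup, 0); (Split, 0)] (isotopy_exchange Split 1 Cap 0) [:: (Cap, 2)].
apply: (@eqw_trans _ _ [:: (Cup, 0); (Cap, 1); (Split, 0); (Split, 1); (Cap, 2)]).
  move_step [:: (Cup, 0)] (isotopy_exchange Split 0 Cap 0) [:: (Split, 1); (Cap, 2)].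
apply: (@eqw_trans _ _ [:: (Split, 0); (Split, 1); (Cap, 2)]).
  move_step ([::] : seq piece) (isotopy_zigzagr 0) [:: (Split, 0); (Split, 1); (Cap, 2)].
back_step [:: (Split, 0)] (isotopy_rotater 1) ([::] : seq piece).
Qed.

Lemma turn_D : eqw d 2 2 (wD ++ turn) [:: (Merge, 0); (Split, 0)].
Proof.
apply: (@eqw_trans _ _ [:: (Cup, 0); (Split, 0); (Merge, 2); (Cap, 2)]).
  back_step [:: (Cup, 0); (Split, 0)] (isotopy_rotater 2) [:: (Cap, 2)].
apply: (@eqw_trans _ _ [:: (Cup, 0); (Merge, 1); (Split, 0); (Cap, 2)]).
  move_step [:: (Cup, 0)] (isotopy_exchange Split 0 Merge 0) [:: (Cap, 2)].
apply: (@eqw_trans _ _ [:: (Cup, 0); (Merge, 1); (Cap, 1); (Split, 0)]).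
  move_step [:: (Cup, 0); (Merge, 1)] (isotopy_exchange Split 0 Cap 0) ([::] : seq piece).
apply: (@eqw_trans _ _ [:: (Cup, 0); (Split, 2); (Cap, 1); (Cap, 1); (Split, 0)]).
  move_step [:: (Cup, 0)] (isotopy_rotatel 1) [:: (Cap, 1); (Split, 0)].
apply: (@eqw_trans _ _ [:: (Split, 0); (Cup, 0); (Cap, 1); (Cap, 1); (Split, 0)]).
  move_step ([::] : seq piece) (isotopy_exchange Cup 0 Split 0) [:: (Cap, 1); (Cap, 1); (Split, 0)].
apply: (@eqw_trans _ _ [:: (Split, 0); (Cap, 1); (Split, 0)]).
  move_step [:: (Split, 0)] (isotopy_zigzagr 0) [:: (Cap, 1); (Split, 0)].
back_step ([::] : seq piece) (isotopy_rotater 0) [:: (Split, 0)].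
Qed.

Lemma turn_I : eqw d 2 2 (wI ++ turn) [:: (Cap, 0); (Cup, 0)].
Proof.
apply: (@eqw_trans _ _ [:: (Cup, 0); (Cap, 2)]).
  move_step [:: (Cup, 0)] (isotopy_zigzagr 2) [:: (Cap, 2)].
move_step ([::] : seq piece) (isotopy_exchange Cup 0 Cap 0) ([::] : seq piece).
Qed.

Lemma turn_E : eqw d 2 2 (wE ++ turn) [::].
Proof.
apply: (@eqw_trans _ _ [:: (Cup, 0); (Cap, 1); (Cup, 1); (Cap, 2)]).
  move_step [:: (Cup, 0)] (isotopy_exchange Cup 1 Cap 0) [:: (Cap, 2)].
apply: (@eqw_trans _ _ [:: (Cup, 1); (Cap, 2)]).
  move_step ([::] : seq piece) (isotopy_zigzagr 0) [:: (Cup, 1); (Cap, 2)].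
move_step ([::] : seq piece) (isotopy_zigzagr 1) ([::] : seq piece).
Qed.

Local Open Scope ring_scope.

Definition delta := (d - 1)^-1.

Lemma sub_relation_DH (V : lmodType C) (e : C) (D H I E : V) :
  1 *: D + (e *: I + (- e *: E + 0)) - H = D - H - e *: (E - I).
Proof.
rewrite scale1r addr0 scalerBr opprB scaleNr -!addrA; congr (_ + _).
by rewrite addrA addrC.
Qed.

(** The relation between D and H, turned: a split feeding a merge is replaced by
   the merge followed by a split, up to graphs with fewer vertices. *)
Lemma flip_DH : eqv d 2 2 (draw [:: (Split, 0%N); (Merge, 1%N)])
  (comb [:: (1, [:: (Merge, 0%N); (Split, 0%N)]);
            (delta, [:: (Cap, 0%N); (Cup, 0%N)]); (- delta, [::])]).
Proof.
apply: (@eqv_trans _ _ (draw (wH ++ turn))); first exact/eqv_sym/turn_H.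
apply: (@eqv_trans _ _ (comb [:: (1, wD ++ turn); (delta, wI ++ turn); (- delta, wE ++ turn)])).
  rewrite draw_cat -[X in eqv _ _ _ _ X](comb_drawr turn [:: (1, wD); (delta, wI); (- delta, wE)]).
  apply: (@eqv_drawr _ _ 2 6) => //; apply: eqv_sym.
  rewrite -[X in eqv _ _ _ X _]shift0 -[X in eqv _ _ _ _ X]shift0.
  apply: eqv_local.
  - have -> : comb [:: (1, wD); (delta, wI); (- delta, wE)] - draw wH =
      draw wD - draw wH - (d - 1)^-1 *: (draw wE - draw wI).
      exact: sub_relation_DH.
    exact: relation_DH.
  - by rewrite shift0; exact: strip_comb.
  by rewrite shift0 strip_drawE.
apply: eqv_comb; first exact: turn_D.
by apply: eqv_comb; [exact: turn_I | apply: eqv_comb; [exact: turn_E | exact: eqv_comb0]].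
Qed.

(** The graph H has the same shape seen from the left and from the right. *)
Lemma flip_HH : eqw d 2 2 [:: (Split, 1%N); (Merge, 0%N)] [:: (Split, 0%N); (Merge, 1%N)].
Proof.
apply: (@eqw_trans _ _ [:: (Split, 1); (Split, 0); (Cap, 1)]%N).
  move_step [:: (Split, 1%N)] (isotopy_rotater 0) ([::] : seq piece).
apply: (@eqw_trans _ _ [:: (Split, 0); (Split, 2); (Cap, 1)]%N).
  back_step ([::] : seq piece) (isotopy_exchange Split 0 Split 0) [:: (Cap, 1%N)].
back_step [:: (Split, 0%N)] (isotopy_rotatel 1) ([::] : seq piece).
Qed.

End Local.

(** * Reduction to cups and splits *)

Section Reduction.
Context {C : numClosedFieldType} (d : C).
Implicit Types (x y z : @drawing C) (u v w a b : seq piece).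

Lemma skein_mulr m n x v : skein d m x -> strands m n v -> skein d n (x * draw v).
Proof.
move=> sx mv; have := skein_context (i := 0) (j := 0) (u := [::]) (v := v) (k := n) sx.
rewrite shift0 draw_nil mul1r !addn0 !add0n; exact.
Qed.

Definition growing := all (fun a : piece => if a.1 is (Cup | Split) then true else false).

Inductive grown n : @drawing C -> Prop :=
| grown_skein x : skein d n x -> grown n x
| grown_word w : growing w -> closes n w -> grown n (draw w)
| grown_lin c x y : grown n x -> grown n y -> grown n (c *: x + y).

Lemma grown_eqv n x y : eqv d 0 n x y -> grown n y -> grown n x.
Proof.
move=> /eqv_skein xy gy; rewrite -[x](subrK y) -[x - y]scale1r.
by apply: grown_lin gy; exact: grown_skein.
Qed.

Lemma grown0 n : grown n 0.
Proof. by apply: grown_skein; exact: skein0. Qed.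

Lemma grown_comb n c a s :
  grown n (draw a) -> grown n (comb s) -> grown n (comb ((c, a) :: s)).
Proof. exact: grown_lin. Qed.

Lemma grown_mulr n m v x :
  (forall u, growing u -> closes n u -> grown m (draw (u ++ v))) ->
  strands n m v -> grown n x -> grown m (x * draw v).
Proof.
move=> gv nv; elim=> {x} [x sx|u gu un|c x y _ IHx _ IHy].
- by apply: grown_skein; exact: skein_mulr nv.
- by rewrite -draw_cat; exact: gv.
by rewrite -> drawing_linl; exact: grown_lin.
Qed.

Lemma grown_grow n m v x : growing v -> strands n m v -> grown n x -> grown m (x * draw v).
Proof.
move=> gv nv; apply: grown_mulr => // u gu un; apply: grown_word.
  by rewrite /growing all_cat; apply/andP.
exact: strands_catW un nv.
Qed.

Lemma grown_near k m l r m0 n0 u w y :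
  closes k u -> k = (l + (m0 + r))%N -> m = (l + (n0 + r))%N -> eqv d m0 n0 (draw w) y ->
  grown m (draw u * shift l y) -> grown m (draw (u ++ shift_word l w)).
Proof.
move=> ku kE mE wy; subst k m; apply: grown_eqv; rewrite draw_cat -shift_draw.
exact: eqv_drawl (eqv_shift l r wy) ku.
Qed.

Lemma grown_nearw k m l r m0 n0 u w w' :
  closes k u -> k = (l + (m0 + r))%N -> m = (l + (n0 + r))%N -> eqw d m0 n0 w w' ->
  grown m (draw (u ++ shift_word l w')) -> grown m (draw (u ++ shift_word l w)).
Proof.
move=> ku kl ml ww; rewrite [draw (u ++ shift_word l w')]draw_cat -[draw (shift_word l w')]shift_draw.
exact: grown_near ku kl ml ww.
Qed.

(** The last piece of the word is a cup or a split.  If it is disjoint from the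
   new piece they are exchanged; otherwise the two form a loop, a zigzag, a
   lollipop, a bigon, a vertex that is merely rotated, or the graph H, and at
   most one cap or merge is left, directly above a shorter word. *)
Lemma grown_shrink u k m t i : growing u -> closes k u ->
  (if t is (Cap | Merge) then true else false) -> strands k m [:: (t, i)] ->
  grown m (draw (u ++ [:: (t, i)])).
Proof.
elim/last_ind: u k m t i => [|u [s j] IHu] k m t i gu ku tt.
  by move: ku; rewrite strands_nil => /eqP<-; rewrite strands_cons /=; case: t tt => //= _; rewrite addn2.
move=> km; move: gu ku; rewrite -cats1 /growing all_cat => /andP[gu].
rewrite /= andbT => gs /strands_cat_inv[l lu lk].
have {}IHu n t' i' := fun h1 h2 => IHu l n t' i' gu lu h1 h2.
have gw := grown_word gu lu.
move: lk km; rewrite !strands_cons !strands_nil /= => lk km.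
have out2 : outs s = 2 by case: (s) gs.
have in2 : ins t = 2 by case: (t) tt.
rewrite -catA /=.
(* The new piece lies on the left of the last one. *)
have [ij|ji] := leqP (i + 2) j.
  apply: (@grown_eqv _ _ (draw (u ++ [:: (t, i); (s, j - 2 + outs t)%N]))).
    apply: eqw_catl lu _; apply: eqw_sym.
    have := isotopy_exchange t i s (j - i - 2)%N.
    have -> : (i + outs t + (j - i - 2) = j - 2 + outs t)%N by lia.
    have -> : (i + ins t + (j - i - 2) = j)%N by lia.
    by move/eqw_isotopy; apply; strands.
  rewrite -[[:: (t, i); _]]/([:: (t, i)] ++ [:: (s, (j - 2 + outs t)%N)]) catA draw_cat.
  apply: (@grown_grow (l - 2 + outs t)); first by rewrite /growing /= gs.
    by strands.
  by apply: IHu => //; strands.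
(* The new piece lies on its right. *)
have [ij|ij] := leqP (j + 2) i.
  apply: (@grown_eqv _ _ (draw (u ++ [:: (t, i - 2 + ins s)%N; (s, j)]))).
    apply: eqw_catl lu _.
    have := isotopy_exchange s j t (i - j - 2)%N.
    have -> : (j + outs s + (i - j - 2) = i)%N by lia.
    have -> : (j + ins s + (i - j - 2) = i - 2 + ins s)%N by lia.
    by move/eqw_isotopy; apply; strands.
  rewrite -[[:: (t, _); _]]/([:: (t, (i - 2 + ins s)%N)] ++ [:: (s, j)]) catA draw_cat.
  apply: (@grown_grow (l - 2 + outs t)); first by rewrite /growing /= gs.
    by strands.
  by apply: IHu => //; strands.
have DH r e : l = (r + 2 + e)%N -> m = l ->
    grown m (draw u * shift r (comb [:: (1, [:: (Merge, 0%N); (Split, 0%N)]);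
      (delta d, [:: (Cap, 0%N); (Cup, 0%N)]); (- delta d, [::])])).
  move=> le me; rewrite comb_shift comb_drawl [X in comb X]/= /shift_piece [X in comb X]/= addn0.
  have two t0 s0 : (if t0 is (Cap | Merge) then true else false) ->
      growing [:: (s0, r)] -> (outs t0 + outs s0 = 2 + ins s0)%N ->
      (ins s0 <= outs t0)%N -> grown m (draw (u ++ [:: (t0, r); (s0, r)])).
    move=> tt0 gs0 ts0 ts1.
    rewrite -[[:: (t0, r); _]]/([:: (t0, r)] ++ [:: (s0, r)]) catA draw_cat.
    have in0 : ins t0 = 2 by case: (t0) tt0.
    apply: (@grown_grow (l - 2 + outs t0)) => //; first by strands.
    by apply: IHu => //; strands.
  apply: grown_comb; first exact: two.
  apply: grown_comb; first exact: two.
  apply: grown_comb; last exact: grown0.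
  by rewrite cats0 me.
have {ij ji} [ij|[ij|ij]] : i = j \/ i = j.+1 \/ j = i.+1 by lia.
- subst j; rewrite (_ : [:: (s, i); (t, i)] = shift_word i [:: (s, 0); (t, 0)]%N); last first.
    by rewrite /shift_word /shift_piece /= addn0.
  case: s gs out2 lk => [_ _ lk|//|_ _ lk|//];
    (case: t tt in2 km => [//|_ _ km|//|_ _ km]); rewrite /ins /outs in lk km.
  + apply: (@grown_near l m i (l - i) 0 0 _ _ _ lu _ _ (loop_value d)); try lia.
    rewrite comb_shift comb_drawl; apply: grown_comb; last exact: grown0.
    by rewrite cats0; have -> : m = l by lia.
  + apply: (@grown_near l m i (l - i) 0 1 _ _ _ lu _ _ (lollipop_merge d)); try lia.
    by rewrite -> shift_0, drawing_mulr0; exact: grown0.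
  + apply: (@grown_near l m i (l - i - 1) 1 0 _ _ _ lu _ _ (lollipop_cap d)); try lia.
    by rewrite -> shift_0, drawing_mulr0; exact: grown0.
  apply: (@grown_nearw l m i (l - i - 1) 1 1 _ _ _ lu _ _ (bigon_value d)); try lia.
  by rewrite cats0; have -> : m = l by lia.
- subst i; rewrite (_ : [:: (s, j); (t, j.+1)] = shift_word j [:: (s, 0); (t, 1)]%N); last first.
    by rewrite /shift_word /shift_piece /= addn0 addn1.
  case: s gs out2 lk => [_ _ lk|//|_ _ lk|//];
    (case: t tt in2 km => [//|_ _ km|//|_ _ km]); rewrite /ins /outs in lk km.
  + apply: (@grown_nearw l m j (l - j - 1) 1 1 _ _ [::] lu); try lia.
      by apply: eqw_isotopy; [exact: isotopy_zigzagr | |].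
    by rewrite cats0; have -> : m = l by lia.
  + apply: (@grown_nearw l m j (l - j - 1) 1 2 _ _ _ lu _ _ (split_cupr d)); try lia.
    rewrite draw_cat; apply: grown_grow gw => //.
    by strands.
  + apply: (@grown_nearw l m j (l - j - 2) 2 1 _ _ _ lu _ _ (merge_capr d)); try lia.
    by apply: IHu => //; strands.
  apply: (@grown_near l m j (l - j - 2) 2 2 _ _ _ lu _ _ (flip_DH d)); try lia.
  by apply: (DH _ (l - j - 2)%N); lia.
subst j; rewrite (_ : [:: (s, i.+1); (t, i)] = shift_word i [:: (s, 1); (t, 0)]%N); last first.
  by rewrite /shift_word /shift_piece /= addn0 addn1.
case: s gs out2 lk => [_ _ lk|//|_ _ lk|//];
    (case: t tt in2 km => [//|_ _ km|//|_ _ km]); rewrite /ins /outs in lk km.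
+ apply: (@grown_nearw l m i (l - i - 1) 1 1 _ _ [::] lu); try lia.
    by apply: eqw_isotopy; [exact: isotopy_zigzagl | |].
  by rewrite cats0; have -> : m = l by lia.
+ apply: (@grown_nearw l m i (l - i - 1) 1 2 _ _ _ lu _ _ (split_cupl d)); try lia.
  rewrite draw_cat; apply: grown_grow gw => //.
  by strands.
+ apply: (@grown_nearw l m i (l - i - 2) 2 1 _ _ _ lu _ _ (merge_capl d)); try lia.
  by apply: IHu => //; strands.
apply: (@grown_nearw l m i (l - i - 2) 2 2 _ _ _ lu _ _ (flip_HH d)); try lia.
apply: (@grown_near l m i (l - i - 2) 2 2 _ _ _ lu _ _ (flip_DH d)); try lia.
by apply: (DH _ (l - i - 2)%N); lia.
Qed.

End Reduction.

(** * Negligible drawings *)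

Section Null.
Context {C : numClosedFieldType} (d : C).
Implicit Types (x y z : @drawing C) (u v w a b r : seq piece).

Lemma grown_disc n x : x \in disc n -> grown d n x.
Proof.
move=> xn; elim/(@draw_ind C): xn => [|c y z IHy IHz|w wn].
- exact: grown0.
- exact: grown_lin.
elim/last_ind: w n wn => [|w [s i] IHw] n; first exact: grown_word.
rewrite -cats1 => /strands_cat_inv[k wk kn].
rewrite draw_cat; apply: (grown_mulr _ kn (IHw _ wk)) => u gu uk.
have [gs|gs] := boolP (growing [:: (s, i)]).
  by apply: grown_word (strands_catW uk kn); rewrite /growing all_cat; apply/andP.
by apply: grown_shrink gu uk _ kn; case: (s) gs.
Qed.

Lemma growing_leq m n w : growing w -> strands m n w -> (m + size w <= n)%N.
Proof.
elim: w m => [|[s i] w IHw] m; first by rewrite strands_nil addn0 => _ /eqP->.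
rewrite strands_cons => /andP[gs gw] /andP[im /(IHw _ gw)]; move: gs im => /=.
by case: s => //= _; lia.
Qed.

Lemma growing_closes n w : growing w -> closes n w ->
  [\/ n = 0%N /\ w = [::], n = 2 /\ w = [:: (Cup, 0%N)] | (2 < n)%N].
Proof.
case: w => [|[s i] w]; first by rewrite strands_nil => _ /eqP<-; constructor 1.
rewrite strands_cons /= => /andP[gs gw] /andP[im wn].
have {gs} sc : s = Cup by case: (s) gs im => //; rewrite addn1.
subst s; have i0 : i = 0%N by move: im; rewrite /=; lia.
subst i; have := growing_leq gw wn; case: w gw wn => [|a w] _ wn /=; last first.
  by move=> ?; constructor 3; lia.
by move: wn; rewrite strands_nil => /eqP <- _; constructor 2.
Qed.

(** The first piece of a word of cups and splits is a cup, and the number of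
   strands never decreases. *)
Lemma disc1_skein x : x \in disc 1 -> skein d 1 x.
Proof.
move/grown_disc; elim=> {x} [//|w gw wn|c x y _ IHx _ IHy].
  by have [[]|[]|] := growing_closes gw wn.
exact: skein_lin.
Qed.

Lemma scalerMD0 (V : lmodType C) (c e f : C) (x : V) :
  (c * e + f) *: x + 0 = c *: (e *: x + 0) + (f *: x + 0).
Proof. by rewrite !addr0 scalerDl scalerA. Qed.

(** The only word of cups and splits with two boundary points is a cup. *)
Lemma disc2_scalar x : x \in disc 2 ->
  exists c, eqv d 0 2 x (comb [:: (c, [:: (Cup, 0%N)])]).
Proof.
move/grown_disc; elim=> {x} [x sx|w gw wn|c x y _ [a IHx] _ [b IHy]].
- exists 0; apply: skein_eqv; last exact: strip_comb.
  by rewrite /comb /= scale0r addr0 subr0.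
- exists 1; have [[]//|[_ ->]|] := growing_closes gw wn; last by [].
  by rewrite /comb /= addr0 scale1r; exact: eqw_refl.
exists (c * a + b).
have -> : comb [:: (c * a + b, [:: (Cup, 0%N)])]
        = c *: comb [:: (a, [:: (Cup, 0%N)])] + comb [:: (b, [:: (Cup, 0%N)])] :> @drawing C.
  exact: scalerMD0.
exact: eqv_lin.
Qed.

(** If [r] closes a disc with [n] boundary points together with a strand that
   passes below the disc, then [around n r] closes the disc alone: the strand now
   leaves [r] on both sides and meets itself above. *)
Definition around n r := [:: (Cup, 0%N); (Cup, n.+2)] ++ shift_word 1 r ++ [:: (Cap, 0%N)].

Lemma strands_around n r : strands n.+2 0 r -> strands n 0 (around n r).
Proof.
move=> rn; rewrite /around !strands_cons; apply/andP; split; first by [].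
apply/andP; split; first by rewrite /=; lia.
have := strands_shift 1 1 rn; rewrite add0n => r1.
apply: (@strands_catW _ 2); last by [].
by move: r1; congr (strands _ _ _) => /=; lia.
Qed.

(** Cutting the strand yields an operator [V] on one strand; the two graphs are
   its closures on the two sides.  As [V] is a scalar modulo the relations, with
   the same scalar whether it is read on the left or on the right leg of a cup,
   the closures agree. *)
Lemma eqw_sphere n w r : closes n w -> strands n.+2 0 r ->
  eqw d 0 0 ((Cup, 0%N) :: shift_word 1 w ++ r) (w ++ around n r).
Proof.
move=> wn rn.
pose V := shift_word 1 w ++ [:: (Cup, n.+1)] ++ r.
have V11 : strands 1 1 V.
  apply: (@strands_catW _ n.+1).
    by have := strands_shift 1 0 wn; rewrite !addn0 add1n.
  apply: (@strands_catW _ n.+3); first by strands.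
  by have := strands_shiftr 1 rn; rewrite addn1 add0n.
pose cup := [:: (Cup, 0%N)]; pose cap := [:: (Cap, 0%N)].
have Wl2 : closes 2 (cup ++ V) by exact: (strands_shiftr 1 V11).
have Wr2 : closes 2 (cup ++ shift_word 1 V) by exact: (strands_shiftl 1 V11).
have [c Wlc] := disc2_scalar (strip_draw Wl2 : draw _ \in _).
(* On the right leg, a zigzag replaces [V] by a copy on the left leg of a cup. *)
have Wrc : eqv d 0 2 (draw (cup ++ shift_word 1 V)) (comb [:: (c, cup)]).
  apply: (@eqv_trans _ _ (draw (cup ++ shift_word 1 (cup ++ V) ++ [:: (Cap, 2)]))).
    apply: (@eqw_trans _ _ (cup ++ [:: (Cup, 1%N); (Cap, 2)] ++ shift_word 1 V)).
      apply: (@eqw_catl _ _ _ 2); first by [].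
      apply: (@eqw_catr _ _ _ 2 _ _ [::]); last exact: (strands_shiftl 1 V11).
      by apply: eqw_sym; apply: eqw_isotopy; [exact: isotopy_zigzagr | |].
    rewrite shift_word_cat -catA.
    apply: (@eqw_catl _ _ _ 2); first by [].
    apply: (@eqw_catl _ _ _ 4 _ [:: (Cup, 1%N)]); first by [].
    have := eqw_shift 1 0 (eqw_far d V11 (isT : strands 2 0 cap)).
    by rewrite !shift_word_cat => /eqw_sym.
  apply: (@eqv_trans _ _ (comb [:: (c, cup ++ [:: (Cup, 1%N); (Cap, 2)])])); last first.
    apply: eqv_comb (eqv_comb0 _ _ _); apply: (@eqw_catl _ _ _ 2 _ _ _ [::]); first by [].
    by apply: eqw_isotopy; [exact: isotopy_zigzagr | |].
  have := eqv_shift 1 1 Wlc; rewrite comb_shift shift_draw => ww.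
  have := eqv_drawl (eqv_drawr ww (isT : strands 4 2 [:: (Cap, 2)])) (isT : strands 0 2 cup).
  by rewrite -> comb_drawr, comb_drawl, <- !draw_cat.
have WlWr : eqw d 0 2 (cup ++ V) (cup ++ shift_word 1 V).
  exact: eqv_trans Wlc (eqv_sym Wrc).
apply: (@eqw_trans _ _ ((cup ++ V) ++ cap)).
  apply: eqw_sym; rewrite -catA /V -!catA.
  rewrite -[_ :: _ ++ _]/(cup ++ shift_word 1 w ++ [::] ++ r) .
  apply: (@eqw_catl _ _ _ 2); first by [].
  apply: (@eqw_catl _ _ _ n.+2).
    by move: (strands_shift 1 1 wn); congr (strands _ _ _); lia.
  apply: (@eqw_trans _ _ ([:: (Cup, n.+1)] ++ [:: (Cap, n.+2)] ++ r)).
    apply: (@eqw_catl _ _ _ n.+4); first by strands.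
    have := eqw_far d rn (isT : strands 2 0 cap).
    by rewrite shift_word0 addn2 addn0 /shift_word /= /shift_piece /= addn0.
  rewrite catA; apply: (@eqw_catr _ _ _ n.+2) => //.
  by apply: eqw_isotopy; [exact: isotopy_zigzagr | strands | strands].
apply: (@eqw_trans _ _ ((cup ++ shift_word 1 V) ++ cap)).
  exact: eqw_catr WlWr _.
rewrite /V !shift_word_cat -!catA shift_wordD /around.
have cw := eqw_far d (isT : strands 0 2 cup) wn.
rewrite catA [X in eqw _ _ _ _ X](catA w cup _).
apply: (eqw_catr (k := (2 + n)%N)); first by move: cw; rewrite shift_word0.
have := strands_around rn; rewrite /around strands_cons => /andP[_].
by rewrite /= subn0 addn2.
Qed.

(** The radical of the form, tested on words instead of mirror images.  It
   contains the skein relations, hence it is the kernel of the quotient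
   [Q d n]. *)
Definition negligible n x :=
  x \in disc n /\ forall r, strands n 0 r -> skein d 0 (x * draw r).

Lemma negligible_skein n x : skein d n x -> negligible n x.
Proof. by move=> sx; split; [exact: skein_disc sx | move=> r; exact: skein_mulr]. Qed.

Lemma negligible_eqv n x y : eqv d 0 n x y -> negligible n y -> negligible n x.
Proof.
move=> xy [yn yr]; split; first by case: xy.
move=> r rn; rewrite -[x * draw r](subrK (y * draw r)).
by apply: skeinD (yr r rn); apply: eqv_skein; exact: eqv_drawr rn.
Qed.

Lemma negligible0 n : negligible n 0.
Proof. by apply: negligible_skein; exact: skein0. Qed.

Lemma negligible_lin n c x y : negligible n x -> negligible n y -> negligible n (c *: x + y).
Proof.
move=> [xn xr] [yn yr]; split=> [|r rn]; first by apply: rpredD yn; apply: rpredZ.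
by rewrite -> drawing_linl; apply: skein_lin; [exact: xr | exact: yr].
Qed.

Lemma negligible_mulr n m x v : negligible n x -> strands n m v -> negligible m (x * draw v).
Proof.
move=> [xn xr] nm; split=> [|r rn]; first exact: strip_mulr nm.
have -> : x * draw v * draw r = x * draw (v ++ r) by rewrite draw_cat mulrA.
exact/xr/strands_catW/rn.
Qed.

Lemma negligible_under n x : negligible n x -> negligible n.+2 (draw [:: (Cup, 0%N)] * shift 1 x).
Proof.
move=> [xn xr].
have x2 : draw [:: (Cup, 0%N)] * shift 1 x \in disc n.+2.
  apply: (@strip_mull _ _ 2) => //; have -> : n.+2 = (1 + (n + 1))%N by lia.
  exact: (strip_shift 1 1 xn).
split=> // r rn.
rewrite -[X in skein _ _ X](subrK (x * draw (around n r))).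
apply: skeinD (xr _ (strands_around rn)); apply: eqv_skein.
elim/(@draw_ind C): xn {xr x2} => [|c y z IHy IHz|w wn].
- rewrite -> shift_0, drawing_mulr0, 2!drawing_mul0r; apply/eqv_refl/rpred0.
- rewrite -> shift_lin, drawing_linr, 2!drawing_linl; exact: eqv_lin.
rewrite shift_draw -!draw_cat; exact: eqw_sphere.
Qed.

(** Induction on the part [u] of the graph that is drawn before [x].  Its last
   piece slides above [x] unless [x] lies between the two strands that the piece
   creates.  A cup below [x] is absorbed in [x] by [negligible_under], and a split
   is a merge after a cup. *)
Lemma negligible_context n x u i j : negligible n x -> closes (i + j) u ->
  negligible (i + (n + j)) (draw u * shift i x).
Proof.
elim/last_ind: u n x i j => [|u [s p] IHu] n x i j nx.
  rewrite strands_nil draw_nil mul1r => /eqP ij.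
  have [-> ->] : i = 0%N /\ j = 0%N by lia.
  by rewrite addn0 add0n shift0.
rewrite -cats1 => /strands_cat_inv[l ul lk].
have [xn _] := nx; move: (lk); rewrite strands_cons strands_nil /= => lk'.
have nxu i' j' : l = (i' + j')%N -> negligible (i' + (n + j')) (draw u * shift i' x).
  by move=> lE; apply: IHu nx _; rewrite -lE.
have nxu2 i' j' : l = (i' + j')%N ->
    negligible (i' + (n + j').+2) (draw u * (draw [:: (Cup, i')] * shift i'.+1 x)).
  move=> lE; rewrite -[i'.+1]addn1 -shiftD.
  have -> : draw [:: (Cup, i')] = shift i' (draw [:: (Cup, 0%N)]) :> @drawing C.
    by rewrite shift_draw /shift_word /shift_piece /= addn0.
  rewrite -shiftM -[(n + j').+2]/(n.+2 + j')%N; apply: IHu (negligible_under nx) _.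
  by rewrite -lE.
rewrite draw_cat -mulrA.
have [ip|ltpi] := leqP i p.
  apply: (@negligible_eqv _ _ (draw u * (shift i x * draw [:: (s, (n + p)%N)]))).
    apply: eqv_drawl ul; apply: eqv_sym.
    have pij : strands (l - i) j [:: (s, (p - i)%N)] by strands.
    have := eqv_shift i 0 (eqv_far d xn (strip_draw pij)).
    rewrite -> !shiftM, !shiftD, !shift_draw.
    rewrite !addn0 ?add0n /shift_word /= /shift_piece /= ?addn0.
    have -> : (i + n + (p - i) = n + p)%N by lia.
    have -> : (i + (p - i) = p)%N by lia.
    by have -> : (i + (l - i) = l)%N by lia.
  rewrite mulrA; apply: negligible_mulr (nxu i (l - i)%N _) _; first by lia.
  by strands.
have [sp|sp] := leqP (p + outs s) i.
  pose a := (i - outs s + ins s)%N.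
  apply: (@negligible_eqv _ _ (draw u * (shift a x * draw [:: (s, p)]))).
    apply: eqv_drawl ul.
    have pij : strands a i [:: (s, p)] by rewrite /a; strands.
    have := eqv_shift 0 j (eqv_far d (strip_draw pij) xn).
    rewrite -> !shift0; rewrite !add0n !addn0 addnA.
    have <- : (a + j = l)%N by rewrite /a; lia.
    exact.
  rewrite mulrA; apply: negligible_mulr (nxu a j _) _; first by rewrite /a; lia.
  by rewrite /a; strands.
have [i1 s2] : i = p.+1 /\ outs s = 2 by case: (s) sp => /=; lia.
subst i; case: s s2 lk lk' {sp} => [_ lk lk'|//|_ lk lk'|//].
  have -> : (p.+1 + (n + j) = p + (n + (l - p)).+2)%N.
    by move: lk' => /=; lia.
  by apply: nxu2; move: lk' => /=; lia.
apply: (@negligible_eqv _ _ (draw u * (draw [:: (Cup, p.+1)] * shift p.+2 x * draw [:: (Merge, p)]))).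
  apply: eqv_drawl ul.
  apply: (@eqv_trans _ _ (draw [:: (Cup, p.+1)] * (draw [:: (Merge, p)] * shift p.+1 x))).
    rewrite -> mulrA, <- draw_cat; apply: (@eqv_mul _ _ _ (p.+1 + j)); last first.
      by apply: eqv_refl; exact: (strip_shift p.+1 j xn).
    have := eqw_shift p (j - 1) (eqw_sym (split_cupl d)).
    rewrite /shift_word /= /shift_piece /= addn0 addn1.
    by congr (eqv _ _ _ _ _); move: lk' => /=; lia.
  rewrite <- mulrA; apply: (@eqv_drawl _ _ _ l.+2); last by move: lk' => /=; strands.
  have pij : strands p.+2 p.+1 [:: (Merge, p)] by strands.
  have := eqv_shift 0 j (eqv_far d (strip_draw pij) xn).
  rewrite -> !shift0; rewrite !add0n !addn0 addnA.
  have -> : (p.+2 + j = l.+2)%N by move: lk' => /=; lia.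
  exact.
rewrite [X in negligible _ X]mulrA; apply: negligible_mulr (nxu2 p.+1 (l - p.+1)%N _) _.
  by move: lk' => /=; lia.
by move: lk' => /=; strands.
Qed.

End Null.

(** * Passing a vertex through two tensors *)

Section LocalIdentity.
Context {C : numClosedFieldType} (d : C).
Implicit Types (x y z : @drawing C) (u v w : seq piece) (c : C).

Local Notation S i := (Split, i%N).
Local Notation M i := (Merge, i%N).
Local Notation P i := (Cap, i%N).
Local Notation U i := (Cup, i%N).
Local Notation delta := (delta d).
Let nil : seq piece := [::].

(* The inverse of [flip_DH] is obtained by solving for the term D. *)
Lemma flip_cancel (V : lmodType C) (e : C) (x y z : V) :
  1 *: (1 *: x + (e *: y + (- e *: z + 0))) + (- e *: y + (e *: z + 0)) = x.
Proof.
rewrite !addr0 !scale1r !scaleNr.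
have -> : - (e *: y) + e *: z = - (e *: y - e *: z) by rewrite opprB addrC.
exact: addrK.
Qed.

Lemma flip_HD : eqv d 2 2 (draw [:: M 0; S 0])
  (comb [:: (1, [:: S 0; M 1]); (- delta, [:: P 0; U 0]); (delta, [:: ])]).
Proof.
have IE : eqv d 2 2 (comb [:: (- delta, [:: P 0; U 0]); (delta, [:: ])])
    (comb [:: (- delta, [:: P 0; U 0]); (delta, [:: ])]).
  by apply: eqv_refl; exact: strip_comb.
have E := flip_cancel delta (draw [:: M 0; S 0] : @drawing C)
  (draw [:: P 0; U 0]) (draw [::]).
rewrite <- E; apply: eqv_sym; exact: (eqv_lin 1 (flip_DH d) IE).
Qed.

Lemma eqv_at l e m0 n0 m n u w v s : eqv d m0 n0 (draw w) (comb s) ->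
  strands m (l + (m0 + e)) u -> strands (l + (n0 + e)) n v ->
  eqv d m n (draw (u ++ shift_word l w ++ v))
            (comb [seq (p.1, u ++ shift_word l p.2 ++ v) | p <- s]).
Proof.
move=> ws mu nv; have := eqv_drawl (eqv_drawr (eqv_shift l e ws) nv) mu.
rewrite -> comb_shift, comb_drawr, comb_drawl, shift_draw, <- !draw_cat.
by rewrite -!map_comp.
Qed.

Lemma eqw_at l e m0 n0 m n u w w' v : eqw d m0 n0 w w' ->
  strands m (l + (m0 + e)) u -> strands (l + (n0 + e)) n v ->
  eqw d m n (u ++ shift_word l w ++ v) (u ++ shift_word l w' ++ v).
Proof.
by move=> ww mu nv; apply: eqw_catl mu _; apply: eqw_catr nv; exact: eqw_shift.
Qed.

Local Notation at_23 l e u v H := (@eqv_at l e _ _ 2 3 u _ v _ H isT isT).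
Arguments eqw_at l e {m0 n0 m n} u {w w'} v _ _ _.

(** Five boundary points, two below and three above: a tree, then the five unions
   of an arc and a vertex.  The other four trees differ from this one by
   combinations of these unions. *)
Definition basis c1 c2 c3 c4 c5 c6 : @drawing C :=
  comb [:: (c1, [:: S 0; M 1; S 0]); (c2, [:: S 1]); (c3, [:: S 0]);
           (c4, [:: P 0; U 0; S 0]); (c5, [:: M 0; U 0]); (c6, [:: M 0; U 1])].

Lemma basis_lin c a1 a2 a3 a4 a5 a6 b1 b2 b3 b4 b5 b6 :
  c *: basis a1 a2 a3 a4 a5 a6 + basis b1 b2 b3 b4 b5 b6
  = basis (c * a1 + b1) (c * a2 + b2) (c * a3 + b3) (c * a4 + b4)
          (c * a5 + b5) (c * a6 + b6).
Proof.
have lin6 (V : lmodType C) (x1 x2 x3 x4 x5 x6 : V) :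
  c *: (a1 *: x1 + (a2 *: x2 + (a3 *: x3 + (a4 *: x4 + (a5 *: x5 + (a6 *: x6 + 0))))))
  + (b1 *: x1 + (b2 *: x2 + (b3 *: x3 + (b4 *: x4 + (b5 *: x5 + (b6 *: x6 + 0))))))
  = (c * a1 + b1) *: x1 + ((c * a2 + b2) *: x2 + ((c * a3 + b3) *: x3
    + ((c * a4 + b4) *: x4 + ((c * a5 + b5) *: x5 + ((c * a6 + b6) *: x6 + 0))))).
  by rewrite !addr0 !scalerDr !scalerDl !scalerA; do 4!(rewrite addrACA; congr (_ + _)); rewrite addrACA.
exact: lin6.
Qed.

Lemma strip_basis c1 c2 c3 c4 c5 c6 : basis c1 c2 c3 c4 c5 c6 \in strip 2 3.
Proof. exact: strip_comb. Qed.

Lemma basis_eq x a1 a2 a3 a4 a5 a6 b1 b2 b3 b4 b5 b6 :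
  eqv d 2 3 x (basis a1 a2 a3 a4 a5 a6) ->
  a1 = b1 -> a2 = b2 -> a3 = b3 -> a4 = b4 -> a5 = b5 -> a6 = b6 ->
  eqv d 2 3 x (basis b1 b2 b3 b4 b5 b6).
Proof. by move=> ? <- <- <- <- <- <-. Qed.

Lemma basis_cons c w s a1 a2 a3 a4 a5 a6 b1 b2 b3 b4 b5 b6 :
  eqv d 2 3 (draw w) (basis a1 a2 a3 a4 a5 a6) ->
  eqv d 2 3 (comb s) (basis b1 b2 b3 b4 b5 b6) ->
  eqv d 2 3 (comb ((c, w) :: s))
    (basis (c * a1 + b1) (c * a2 + b2) (c * a3 + b3) (c * a4 + b4)
           (c * a5 + b5) (c * a6 + b6)).
Proof. by move=> wa sb; have := eqv_lin c wa sb; rewrite -> basis_lin. Qed.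

Lemma basis_nil : eqv d 2 3 (comb [::]) (basis 0 0 0 0 0 0).
Proof.
have -> : comb [::] = basis 0 0 0 0 0 0.
  have z6 (V : lmodType C) (x1 x2 x3 x4 x5 x6 : V) :
    0 = 0 *: x1 + (0 *: x2 + (0 *: x3 + (0 *: x4 + (0 *: x5 + (0 *: x6 + 0))))) :> V.
    by rewrite !scale0r !add0r.
  exact: z6.
apply: eqv_refl; exact: strip_basis.
Qed.

Lemma basis_word w w' a1 a2 a3 a4 a5 a6 : eqw d 2 3 w w' ->
  eqv d 2 3 (draw w') (basis a1 a2 a3 a4 a5 a6) ->
  eqv d 2 3 (draw w) (basis a1 a2 a3 a4 a5 a6).
Proof. exact: eqv_trans. Qed.

Lemma basis_unit (V : lmodType C) (x1 x2 x3 x4 x5 x6 : V) :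
  let sum a1 a2 a3 a4 a5 a6 := a1 *: x1 + (a2 *: x2 + (a3 *: x3 +
    (a4 *: x4 + (a5 *: x5 + (a6 *: x6 + 0))))) in
  (sum 1 0 0 0 0 0 = x1) * (sum 0 1 0 0 0 0 = x2) * (sum 0 0 1 0 0 0 = x3)
  * (sum 0 0 0 1 0 0 = x4) * (sum 0 0 0 0 1 0 = x5) * (sum 0 0 0 0 0 1 = x6).
Proof. by rewrite /= !scale0r !scale1r !add0r !addr0. Qed.

Lemma basis_draw w a1 a2 a3 a4 a5 a6 : draw w = basis a1 a2 a3 a4 a5 a6 ->
  eqv d 2 3 (draw w) (basis a1 a2 a3 a4 a5 a6).
Proof. by move=> ->; exact/eqv_refl/strip_basis. Qed.

Lemma basis1 : eqv d 2 3 (draw [:: S 0; M 1; S 0]) (basis 1 0 0 0 0 0).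
Proof. apply: basis_draw; exact: (esym (basis_unit _ _ _ _ _ _).1.1.1.1.1). Qed.

Lemma basis2 : eqv d 2 3 (draw [:: S 1]) (basis 0 1 0 0 0 0).
Proof. apply: basis_draw; exact: (esym (basis_unit _ _ _ _ _ _).1.1.1.1.2). Qed.

Lemma basis3 : eqv d 2 3 (draw [:: S 0]) (basis 0 0 1 0 0 0).
Proof. apply: basis_draw; exact: (esym (basis_unit _ _ _ _ _ _).1.1.1.2). Qed.

Lemma basis4 : eqv d 2 3 (draw [:: P 0; U 0; S 0]) (basis 0 0 0 1 0 0).
Proof. apply: basis_draw; exact: (esym (basis_unit _ _ _ _ _ _).1.1.2). Qed.

Lemma basis5 : eqv d 2 3 (draw [:: M 0; U 0]) (basis 0 0 0 0 1 0).
Proof. apply: basis_draw; exact: (esym (basis_unit _ _ _ _ _ _).1.2). Qed.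

Lemma basis6 : eqv d 2 3 (draw [:: M 0; U 1]) (basis 0 0 0 0 0 1).
Proof. apply: basis_draw; exact: (esym (basis_unit _ _ _ _ _ _).2). Qed.

Lemma cup_split : eqw d 0 3 [:: U 0; S 1] [:: U 0; S 0].
Proof.
apply: (@eqw_trans _ _ [:: U 0; U 2; M 1]).
  apply: eqw_sym; exact: (eqw_at 1 0 [:: U 0] nil (split_cupl d)).
apply: (@eqw_trans _ _ [:: U 0; U 0; M 1]).
  move_step nil (isotopy_exchange Cup 0 Cup 0) [:: M 1].
exact: (eqw_at 0 1 [:: U 0] nil (split_cupr d)).
Qed.

Lemma merge_cap : eqw d 3 0 [:: M 1; P 0] [:: M 0; P 0].
Proof.
apply: (@eqw_trans _ _ [:: S 1; P 2; P 0]).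
  move_step nil (isotopy_rotater 1) [:: P 0].
apply: (@eqw_trans _ _ [:: S 1; P 0; P 0]).
  back_step [:: S 1] (isotopy_exchange Cap 0 Cap 0) nil.
back_step nil (isotopy_rotatel 0) [:: P 0].
Qed.

(* The names below record the graphs chosen among H, I and E for the left and for
   the right tensor; the vertex comes first. *)
Lemma word_IE : eqw d 2 3 [:: S 1; P 0; U 0] [:: M 0; U 0].
Proof. exact: (eqw_at 0 0 nil [:: U 0] (merge_capl d)). Qed.

Lemma tree_HE : eqv d 2 3 (draw [:: S 1; S 0; M 1]) (basis 1 (- delta) 0 0 delta 0).
Proof.
have h1 : eqv d 2 3 (draw [:: S 1; M 0; S 0]) (basis 1 0 0 0 0 0).
  apply: basis_word basis1; exact: (eqw_at 0 0 nil [:: S 0] (flip_HH d)).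
have h2 := basis_word word_IE basis5.
apply: (basis_eq (eqv_trans (at_23 0 1 [:: S 1] nil (flip_DH d))
  (basis_cons 1 h1 (basis_cons delta h2 (basis_cons (- delta) basis2 basis_nil))))); ring.
Qed.

Lemma tree_IH : eqv d 2 3 (draw [:: S 1; P 0; U 0; S 1; M 2])
  (basis 1 0 delta (- delta) 0 0).
Proof.
apply: (@basis_word _ [:: M 0; S 0; S 0]).
  apply: (@eqw_trans _ _ [:: M 0; U 0; S 1; M 2]).
    exact: (eqw_at 0 0 nil [:: U 0; S 1; M 2] (merge_capl d)).
  apply: (@eqw_trans _ _ [:: M 0; U 0; S 0; M 2]).
    exact: (eqw_at 0 1 [:: M 0] [:: M 2] cup_split).
  apply: (@eqw_trans _ _ [:: M 0; U 0; M 1; S 0]).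
    move_step [:: M 0; U 0] (isotopy_exchange Split 0 Merge 0) nil.
  exact: (eqw_at 0 0 [:: M 0] [:: S 0] (split_cupr d)).
apply: (basis_eq (eqv_trans (at_23 0 0 nil [:: S 0] flip_HD)
  (basis_cons 1 basis1 (basis_cons (- delta) basis4 (basis_cons delta basis3 basis_nil))))); ring.
Qed.

Lemma word_EI : eqv d 2 3 (draw [:: S 1; P 1; U 1]) (basis 0 0 0 0 0 0).
Proof.
exact: (eqv_trans (@eqv_at 1 0 _ _ 2 3 nil _ [:: U 1] [::] (lollipop_cap d) isT isT) basis_nil).
Qed.

(** A triangle is a vertex times [1 - delta]: flipping one edge leaves a bigon, a
   lollipop and a vertex. *)
Lemma triangle_EH : eqv d 2 3 (draw [:: S 1; S 1; M 2]) (basis 0 (1 - delta) 0 0 0 0).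
Proof.
have h1 : eqv d 2 3 (draw [:: S 1; M 1; S 1]) (basis 0 1 0 0 0 0).
  apply: basis_word basis2; exact: (eqw_at 1 0 nil [:: S 1] (bigon_value d)).
apply: (basis_eq (eqv_trans (at_23 1 0 [:: S 1] nil (flip_DH d))
  (basis_cons 1 h1 (basis_cons delta word_EI (basis_cons (- delta) basis2 basis_nil))))); ring.
Qed.

Lemma word_II : eqw d 2 3 [:: S 1; P 0; U 0; P 1; U 1] [:: M 0; U 1].
Proof.
apply: (@eqw_trans _ _ [:: M 0; U 0; P 1; U 1]).
  exact: (eqw_at 0 0 nil [:: U 0; P 1; U 1] (merge_capl d)).
move_step [:: M 0] (isotopy_zigzagr 0) [:: U 1].
Qed.

Lemma split_comm w : strands 4 3 w -> eqw d 2 3 ([:: S 1; S 0] ++ w) ([:: S 0; S 2] ++ w).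
Proof.
move=> w3; apply: (@eqw_catr _ _ _ 4) w3.
back_step nil (isotopy_exchange Split 0 Split 0) nil.
Qed.

Lemma word_SCU : eqw d 2 3 [:: S 0; P 1; U 1] [:: M 0; U 1].
Proof. exact: (eqw_at 0 0 nil [:: U 1] (merge_capr d)). Qed.

Lemma word_HI : eqw d 2 3 [:: S 1; S 0; M 1; P 1; U 1] [:: M 0; U 1].
Proof.
apply: (@eqw_trans _ _ [:: S 0; S 2; M 1; P 1; U 1]); first exact: split_comm.
apply: (@eqw_trans _ _ [:: S 0; S 1; M 2; P 1; U 1]).
  exact: (eqw_at 1 0 [:: S 0] [:: P 1; U 1] (flip_HH d)).
apply: (@eqw_trans _ _ [:: S 0; S 1; M 1; P 1; U 1]).
  exact: (eqw_at 1 0 [:: S 0; S 1] [:: U 1] merge_cap).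
apply: (@eqw_trans _ _ [:: S 0; P 1; U 1]); last exact: word_SCU.
exact: (eqw_at 1 1 [:: S 0] [:: P 1; U 1] (bigon_value d)).
Qed.

Lemma tree_SSM : eqv d 2 3 (draw [:: S 0; S 1; M 2]) (basis 1 (- delta) 0 0 delta 0).
Proof.
apply: basis_word tree_HE.
apply: (@eqw_trans _ _ [:: S 0; S 2; M 1]).
  exact: (eqw_at 1 0 [:: S 0] nil (eqw_sym (flip_HH d))).
by apply: eqw_sym; exact: split_comm.
Qed.

(** Flipping one edge of the square leaves a triangle, a tree and a bigon. *)
Lemma square_HH : eqv d 2 3 (draw [:: S 1; S 0; M 1; S 1; M 2])
  (basis (1 - delta *+ 2) (- delta * (1 - delta *+ 2)) (delta - delta ^+ 2)
         0 (delta * (1 - delta *+ 2)) (delta ^+ 2)).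
Proof.
have hA : eqv d 2 3 (draw [:: S 1; S 0; S 1; M 2; M 2])
    (basis (1 - delta) (- delta * (1 - delta)) 0 0 (delta * (1 - delta)) 0).
  apply: (@basis_word _ [:: S 0; S 1; S 2; M 3; M 2]).
    apply: (@eqw_trans _ _ [:: S 0; S 2; S 1; M 2; M 2]); first exact: split_comm.
    apply: (@eqw_trans _ _ [:: S 0; S 1; S 3; M 2; M 2]).
      back_step [:: S 0] (isotopy_exchange Split 1 Split 0) [:: M 2; M 2].
    exact: (eqw_at 2 0 [:: S 0; S 1] [:: M 2] (flip_HH d)).
  have h1 : eqv d 2 3 (draw [:: S 0; S 1; M 2; S 2; M 2]) (basis 1 (- delta) 0 0 delta 0).
    apply: basis_word tree_SSM.
    exact: (eqw_at 2 0 [:: S 0; S 1; M 2] nil (bigon_value d)).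
  have h2 : eqv d 2 3 (draw [:: S 0; S 1; P 2; U 2; M 2]) (basis 0 0 0 0 0 0).
    exact: (eqv_trans (@eqv_at 2 0 _ _ 2 3 [:: S 0; S 1; P 2] _ nil [::]
      (lollipop_merge d) isT isT) basis_nil).
  apply: (basis_eq (eqv_trans (at_23 2 0 [:: S 0; S 1] [:: M 2] (flip_DH d))
    (basis_cons 1 h1 (basis_cons delta h2 (basis_cons (- delta) tree_SSM basis_nil))))); ring.
have hB : eqv d 2 3 (draw [:: S 1; S 0; P 1; U 1; M 2])
    (basis 1 (- delta) delta 0 delta (- delta)).
  apply: (@basis_word _ [:: S 0; M 1; S 1]).
    apply: (@eqw_trans _ _ [:: S 1; M 0; U 1; M 2]).
      exact: (eqw_at 0 1 [:: S 1] [:: U 1; M 2] (merge_capr d)).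
    apply: (@eqw_trans _ _ [:: S 1; M 0; S 1]).
      exact: (eqw_at 1 0 [:: S 1; M 0] nil (split_cupr d)).
    exact: (eqw_at 0 0 nil [:: S 1] (flip_HH d)).
  have h2 := basis_word word_SCU basis6.
  apply: (basis_eq (eqv_trans (at_23 1 0 [:: S 0] nil flip_HD)
    (basis_cons 1 tree_SSM (basis_cons (- delta) h2 (basis_cons delta basis3 basis_nil))))); ring.
have hC : eqv d 2 3 (draw [:: S 1; S 0; M 2]) (basis 0 0 1 0 0 0).
  apply: basis_word basis3.
  apply: (@eqw_trans _ _ [:: S 0; S 2; M 2]); first exact: split_comm.
  exact: (eqw_at 2 0 [:: S 0] nil (bigon_value d)).
apply: (basis_eq (eqv_trans (at_23 1 1 [:: S 1; S 0] [:: M 2] flip_HD)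
    (basis_cons 1 hA (basis_cons (- delta) hB (basis_cons delta hC basis_nil))))); ring.
Qed.

Lemma comb_mul (s t : seq (C * seq piece)) :
  comb s * comb t = comb [seq (p.1 * q.1, p.2 ++ q.2) | p <- s, q <- t].
Proof.
elim: s => [|[c w] s IHs]; first exact: drawing_mul0r.
rewrite allpairs_cons comb_cat -IHs; apply: etrans (drawing_linl _ _ _ _) _.
rewrite comb_drawl -comb_scale -map_comp.
by [].
Qed.

Definition operator p q r : @drawing C :=
  comb [:: (p, [:: S 0; M 1]); (q, [:: P 0; U 0]); (r, [::])].

(** The first three equations compare the coefficients of the graphs that occur
   on the side of a single tensor, the last three those of the others. *)
Definition intertwines p q r p0 q0 r0 p1 q1 r1 :=
  [/\ p = p0 * p1 * (1 - delta *+ 2) + p0 * r1 + q0 * p1,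
      q = - delta * q0 * p1 &
      r = (delta - delta ^+ 2) * p0 * p1 + delta * q0 * p1] /\
  [/\ delta * (1 - delta *+ 2) * p0 * p1 + delta * p0 * r1 + q0 * r1 = 0,
      (1 - delta) * r0 * p1 + r0 * r1
        = delta * (1 - delta *+ 2) * p0 * p1 + delta * p0 * r1 &
      delta ^+ 2 * p0 * p1 + p0 * q1 + q0 * q1 = 0].

Lemma operator_split p q r p0 q0 r0 p1 q1 r1 :
  intertwines p q r p0 q0 r0 p1 q1 r1 ->
  eqv d 2 3 (draw [:: S 1] * operator p0 q0 r0 * shift 1 (operator p1 q1 r1))
            (operator p q r * draw [:: S 0]).
Proof.
move=> [[pE qE rE] [e5 e2 e6]].
have R : operator p q r * draw [:: S 0] = basis p 0 r q 0 0.
  have b (V : lmodType C) (x1 x2 x3 x4 x5 x6 : V) :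
    p *: x1 + (q *: x4 + (r *: x3 + 0)) =
    p *: x1 + (0 *: x2 + (r *: x3 + (q *: x4 + (0 *: x5 + (0 *: x6 + 0))))) :> V.
    by rewrite !scale0r !add0r !addr0; congr (_ + _); exact: addrC.
  rewrite comb_drawr; exact: b.
rewrite R; apply: eqv_trans (_ : eqv d 2 3 _ (comb
  [:: (p0 * p1, [:: S 1; S 0; M 1; S 1; M 2]); (p0 * q1, [:: S 1; S 0; M 1; P 1; U 1]);
      (p0 * r1, [:: S 1; S 0; M 1]);
      (q0 * p1, [:: S 1; P 0; U 0; S 1; M 2]); (q0 * q1, [:: S 1; P 0; U 0; P 1; U 1]);
      (q0 * r1, [:: S 1; P 0; U 0]);
      (r0 * p1, [:: S 1; S 1; M 2]); (r0 * q1, [:: S 1; P 1; U 1]);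
      (r0 * r1, [:: S 1])])) _.
  rewrite /operator; rewrite -> comb_drawl, comb_shift, comb_mul.
  by apply: eqv_refl; exact: strip_comb.
apply: (basis_eq (basis_cons (p0 * p1) square_HH (basis_cons (p0 * q1) (basis_word word_HI basis6)
  (basis_cons (p0 * r1) tree_HE (basis_cons (q0 * p1) tree_IH
  (basis_cons (q0 * q1) (basis_word word_II basis6) (basis_cons (q0 * r1) (basis_word word_IE basis5)
  (basis_cons (r0 * p1) triangle_EH (basis_cons (r0 * q1) word_EI
  (basis_cons (r0 * r1) basis2 basis_nil)))))))))).
- rewrite pE; ring.
- transitivity ((1 - delta) * r0 * p1 + r0 * r1
        - (delta * (1 - delta *+ 2) * p0 * p1 + delta * p0 * r1)); first ring.
  by rewrite e2 subrr.
- rewrite rE; ring.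
- rewrite qE; ring.
- rewrite -[RHS]e5; ring.
rewrite -[RHS]e6; ring.
Qed.

End LocalIdentity.

(** * Vectors and their representatives *)

Section Classes.
Context {C : numClosedFieldType} (d : C).
Implicit Types (x y z : @drawing C) (u v w : seq piece).

Lemma radical_negligible n x : radical d n x <-> negligible d n x.
Proof.
split=> [[xn xr]|[xn xr]]; split=> //.
  move=> r rn; have mr : draw (mirror_word r) \in @strip C 0 n.
    by rewrite strip_drawE; exact: strands_mirror.
  have := xr _ mr; rewrite mirror_draw mirror_wordK /evaluates scale0r subr0.
  exact.
move=> y yn; rewrite /evaluates scale0r subr0.
elim/(@draw_ind C): yn => [|c a b IHa IHb|w wn].
- by rewrite mirror0; rewrite -> drawing_mulr0; exact: skein0.
- rewrite mirror_semilinear; apply: (eq_ind _ _ (skein_lin c^* IHa IHb)).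
  exact/esym/drawing_linr.
by rewrite mirror_draw; apply: xr; exact: strands_mirror.
Qed.

Lemma null_negligible n (g : graph_space n) : (g \in @null C d n) <-> negligible d n (val g).
Proof.
split=> [/asboolP[y sy /radical_negligible gy]|ng].
  have := negligible_lin 1 gy (negligible_skein sy).
  by rewrite scale1r subrK.
by apply/asboolP; exists 0; [exact: skein0 | apply/radical_negligible; rewrite subr0].
Qed.

Lemma pi_negligible n (g h : graph_space n) :
  (\pi_(Q d n)%qT g = \pi_(Q d n)%qT h) <-> negligible d n (val g - val h).
Proof.
have <- : val (g - h) = val g - val h by exact: linearB.
rewrite -null_negligible; split=> [gh|gh].
  by rewrite (Quotient.idealrBE (@null C d n) g h); apply/eqP.
by apply/eqP; rewrite -(Quotient.idealrBE (@null C d n) g h).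
Qed.

Definition represents n (X : Q d n) x := x \in disc n /\ negligible d n (rep X - x).

Lemma negligible_neg n x : negligible d n x -> negligible d n (- x).
Proof.
by move=> xn; rewrite -scaleN1r -[_ *: _]addr0; apply: negligible_lin xn _; exact: negligible0.
Qed.

Lemma represents_pi n (g : graph_space n) : represents (\pi_(Q d n)%qT g) (val g).
Proof. by split; [exact: valP | apply/pi_negligible; rewrite reprK]. Qed.

Lemma represents_class n x : x \in disc n -> represents (class d n x) x.
Proof.
move=> xn; have <- : val (insubd 0 x : graph_space n) = x by exact: insubdK.
by rewrite /class valKd; exact: represents_pi.
Qed.

Lemma represents_eq n (X Y : Q d n) x y :
  represents X x -> represents Y y -> negligible d n (x - y) -> X = Y.
Proof.
move=> [xn Xx] [yn Yy] xy; rewrite -[X]reprK -[Y]reprK; apply/pi_negligible.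
rewrite -[val (repr X)]/(rep X) -[val (repr Y)]/(rep Y).
have -> : rep X - rep Y = 1 *: (rep X - x) + (1 *: (x - y) + (- (rep Y - y))).
  have e (V : zmodType) (a b c f : V) : a - b = (a - c) + ((c - f) + - (b - f)).
    by rewrite opprB [_ + (f - b)]addrA subrK addrA subrK.
  by rewrite 2!scale1r; exact: e.
by apply: negligible_lin Xx _; apply: negligible_lin xy _; exact: negligible_neg.
Qed.

Lemma represents_negligible n (X : Q d n) x y :
  represents X x -> y \in disc n -> negligible d n (x - y) -> represents X y.
Proof.
move=> [xn Xx] yn xy; split; first exact: yn.
have -> : rep X - y = 1 *: (rep X - x) + (x - y) by rewrite scale1r addrA subrK.
exact: negligible_lin.
Qed.

Lemma represents_rep n (X : Q d n) : represents X (rep X).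
Proof. by split; [exact: rep_disc | rewrite subrr; exact: negligible0]. Qed.

Lemma represents_lin n (X Y : Q d n) c x y : represents X x -> represents Y y ->
  represents (c *: X + Y) (c *: x + y).
Proof.
move=> [xn Xx] [yn Yy].
have E : c *: X + Y = \pi_(Q d n)%qT (c *: repr X + repr Y).
  by rewrite raddfD /= -scaleQ_pi !reprK.
apply: (@represents_negligible _ _ (c *: rep X + rep Y)).
- by rewrite E; exact: (represents_pi (c *: repr X + repr Y)).
- by apply: rpredD yn; apply: rpredZ.
have -> : c *: rep X + rep Y - (c *: x + y) = c *: (rep X - x) + (rep Y - y).
  by rewrite scalerBr opprD addrACA.
exact: negligible_lin.
Qed.

Lemma represents0 n : represents (0 : Q d n) 0.
Proof.
have -> : (0 : Q d n) = \pi_(Q d n)%qT 0 by rewrite raddf0.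
exact: (represents_pi (0 : graph_space n)).
Qed.

Definition tensor p q r : @drawing C := comb [:: (p, wH); (q, wI); (r, wE)].

Lemma elt4_represents p q r : represents (elt4 d p q r) (tensor p q r).
Proof.
have rw w : closes 4 w -> represents (class d 4 (draw w)) (draw w).
  by move=> w4; apply: represents_class; exact: strip_draw.
have -> : elt4 d p q r = p *: class d 4 (draw wH)
    + (q *: class d 4 (draw wI) + (r *: class d 4 (draw wE) + 0)).
  have e (V : zmodType) (a b f : V) : a + b + f = a + (b + (f + 0)).
    by rewrite addr0 addrA.
  exact: e.
apply: represents_lin; first exact: rw.
apply: represents_lin; first exact: rw.
by apply: represents_lin; [exact: rw | exact: represents0].
Qed.

End Classes.

(** * Attaching a vertex below a transfer matrix *)

Section Transfer.
Context {C : numClosedFieldType} (d : C).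
Implicit Types (x y z : @drawing C) (u v w : seq piece).

Definition same n x y := [/\ x \in disc n, y \in disc n & negligible d n (x - y)].

Lemma same_eqv n x y : eqv d 0 n x y -> same n x y.
Proof. by move=> xy; case: (xy) => xn yn _; split; [| |exact/negligible_skein/eqv_skein]. Qed.

Lemma same_refl n x : x \in disc n -> same n x x.
Proof. by move=> xn; apply: same_eqv; exact: eqv_refl. Qed.

Lemma same_trans y n x z : same n x y -> same n y z -> same n x z.
Proof.
move=> [xn yn xy] [_ zn yz]; split; [exact: xn | exact: zn |].
have -> : x - z = 1 *: (x - y) + (y - z) by rewrite scale1r addrA subrK.
exact: negligible_lin.
Qed.

Lemma same_drawr n m x y v : same n x y -> strands n m v ->
  same m (x * draw v) (y * draw v).
Proof.
move=> [xn yn xy] nm; split; try by apply: strip_mulr nm.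
by rewrite <- drawing_mulrBl; exact: negligible_mulr nm.
Qed.

Lemma same_lin n c x y x' y' : same n x x' -> same n y y' ->
  same n (c *: x + y) (c *: x' + y').
Proof.
move=> [xn x'n xx] [yn y'n yy]; split.
- by apply: rpredD yn; apply: rpredZ.
- by apply: rpredD y'n; apply: rpredZ.
have -> : c *: x + y - (c *: x' + y') = c *: (x - x') + (y - y').
  by rewrite scalerBr opprD addrACA.
exact: negligible_lin.
Qed.

Lemma same_mulr n m x y z : same n x y -> z \in strip n m -> same m (x * z) (y * z).
Proof.
move=> xy zn; elim/(@draw_ind C): zn => [|c a b IHa IHb|w wn].
- by rewrite -> !drawing_mulr0; apply/same_refl/rpred0.
- by rewrite -> 2!drawing_linr; exact: same_lin.
exact: (same_drawr xy wn).
Qed.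

Lemma same_context n x y z i j : z \in disc (i + j) -> same n x y ->
  same (i + (n + j)) (z * shift i x) (z * shift i y).
Proof.
move=> zn [xn yn xy]; elim/(@draw_ind C): zn => [|c a b IHa IHb|w wn].
- by rewrite -> !drawing_mul0r; apply/same_refl/rpred0.
- by rewrite -> 2!drawing_linl; exact: same_lin.
split; [exact: strip_mull wn (strip_shift i j xn) | exact: strip_mull wn (strip_shift i j yn) |].
by rewrite <- drawing_mulrBr; rewrite <- shiftB; exact: negligible_context.
Qed.

Lemma insertE i x : insert i x = shift i (insert 0 x).
Proof.
rewrite /insert shiftM shift0 shift_draw /shift_word /= /shift_piece /=.
by rewrite addn3 addn2.
Qed.

Lemma insert0_strip x : x \in disc 4 -> insert 0 x \in strip 2 2.
Proof. by move=> /(insert_strip 0 0). Qed.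

Definition layers (L : nat -> @drawing C) m n := \prod_(m <= i < n) insert i (L i).

Lemma layers_recr L m n : (m <= n)%N ->
  layers L m n.+1 = layers L m n * insert n (L n).
Proof. by move=> mn; rewrite /layers big_nat_recr. Qed.

Lemma layers0 L m : layers L m m = 1.
Proof. by rewrite /layers big_geq. Qed.

Lemma drawing_mulr1 x : x * (1 : @drawing C) = x. Proof. exact: mulr1. Qed.
Lemma drawing_mul1r x : (1 : @drawing C) * x = x. Proof. exact: mul1r. Qed.

Lemma layers_strip L m n k : (forall i, L i \in disc 4) -> (m <= n)%N -> (n < k)%N ->
  layers L m n \in strip k k.
Proof.
move=> L4 mn; elim: n mn => [|n IHn] mn nk; first by rewrite /layers big_geq // strip1.
have [nm|mn'] := leqP n.+1 m; first by rewrite /layers big_geq // strip1.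
rewrite layers_recr //; apply: (@stripM _ _ k); first by apply: IHn => //; lia.
have -> : k = (n + (2 + (k - n - 2)))%N by lia.
exact: insert_strip.
Qed.

(** One layer at a time: replacing the tensors below changes the graph on the
   bottom of the layer, and replacing the tensor of the layer is the case of
   [same_context]. *)
Lemma layers_same L L' n k x y : (forall i, same 4 (L i) (L' i)) -> (n < k)%N ->
  same k x y -> same k (x * layers L 0 n) (y * layers L' 0 n).
Proof.
move=> LL nk xy; have L4 i : L i \in disc 4 by case: (LL i).
have L'4 i : L' i \in disc 4 by case: (LL i).
elim: n nk => [|n IHn] nk; first by rewrite -> !layers0, !drawing_mulr1.
rewrite -> (layers_recr L (leq0n n)).
rewrite -> (layers_recr L' (leq0n n)).
rewrite -> mulrA.
rewrite -> mulrA.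
have kE : k = (n + (2 + (k - n - 2)))%N by lia.
apply: (@same_trans (y * layers L' 0 n * insert n (L n))).
  apply: same_mulr; first by apply: IHn; lia.
  by rewrite kE; exact: insert_strip.
have yn : y * layers L' 0 n \in disc (n + (k - n)).
  have -> : (n + (k - n) = k)%N by lia.
  by apply: (@stripM _ _ k); [by case: xy | apply: layers_strip => //; lia].
rewrite /insert; rewrite -> !mulrA; apply: (@same_drawr (n + (4 + (k - n)))).
  exact: same_context.
by rewrite !strands_cons strands_nil /=; lia.
Qed.

Definition transfer_word n (L : nat -> @drawing C) x :=
  draw [:: (Cup, 0%N)] * shift 1 x * layers L 0 n * draw [:: (Cap, n)].

Lemma transfer_drawingE n (L : nat -> @drawing C) x :
  transfer_drawing (fun i : 'I_n => L i) x = transfer_word n L x.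
Proof. by rewrite /transfer_word /layers big_mkord. Qed.

Lemma transfer_word_same n L L' x y : (forall i, same 4 (L i) (L' i)) ->
  same n x y -> same n (transfer_word n L x) (transfer_word n L' y).
Proof.
move=> LL xy; apply: (@same_drawr n.+2); last by strands.
apply: layers_same => //.
have -> : n.+2 = (1 + (n + 1))%N by lia.
by apply: same_context xy; rewrite strip_drawE.
Qed.

Lemma eqv_swap k m n x y z y' z' : x \in strip m k ->
  eqv d k n (y * z) (z' * y') -> eqv d m n (x * y * z) (x * z' * y').
Proof.
by move=> xk yz; rewrite <- 2!mulrA; exact: eqv_mul (eqv_refl d xk) yz.
Qed.

Lemma split_above i k n z : z \in strip 2 2 -> (k < i)%N -> (i <= n)%N ->
  eqv d n.+2 n.+3 (draw [:: (Split, i.+1)] * shift k z) (shift k z * draw [:: (Split, i.+1)]).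
Proof.
move=> z2 ki i_n; apply: eqv_sym.
have ps : strands (n - k) (n - k).+1 [:: (Split, (i.-1 - k)%N)] by strands.
have := eqv_shift k 0 (eqv_far d z2 (strip_draw ps)).
rewrite -> !shiftM, !shiftD, !shift_draw; rewrite /shift_word /= /shift_piece /=.
have -> : (k + 2 + (i.-1 - k) = i.+1)%N by lia.
have -> : (k + (2 + (n - k) + 0) = n.+2)%N by lia.
by have -> : (k + (2 + (n - k).+1 + 0) = n.+3)%N by lia.
Qed.

Lemma split_layers i m n L : (forall k, L k \in disc 4) -> (m <= i)%N -> (i <= n)%N ->
  eqv d n.+2 n.+3 (draw [:: (Split, i.+1)] * layers L 0 m)
                  (layers L 0 m * draw [:: (Split, i.+1)]).
Proof.
move=> L4 mi i_n; have sp : strands n.+2 n.+3 [:: (Split, i.+1)] by strands.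
elim: m mi => [|m IHm] mi.
  by rewrite -> layers0, drawing_mulr1, drawing_mul1r; apply: eqv_refl; rewrite strip_drawE.
rewrite -> (layers_recr _ (leq0n m)), mulrA.
apply: (@eqv_trans _ _ (layers L 0 m * draw [:: (Split, i.+1)] * insert m (L m))).
  apply: eqv_mul (IHm _) _; first by lia.
  apply: eqv_refl; have -> : n.+3 = (m + (2 + (n.+1 - m)))%N by lia.
  exact: insert_strip.
apply: (@eqv_swap n.+2); first by apply: layers_strip => //; lia.
rewrite [insert m (L m)]insertE.
by apply: split_above => //; exact: insert0_strip.
Qed.

Lemma split_below i k n z : z \in strip 2 2 -> (i < k)%N -> (k < n)%N ->
  eqv d n.+2 n.+3 (draw [:: (Split, i)] * shift k.+1 z) (shift k z * draw [:: (Split, i)]).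
Proof.
move=> z2 ik kn.
have ps : strands k k.+1 [:: (Split, i)] by strands.
have := eqv_shift 0 (n - k) (eqv_far d (strip_draw ps) z2).
rewrite -> !shift0; rewrite !add0n.
have -> : (k + 2 + (n - k) = n.+2)%N by lia.
by have -> : (k.+1 + 2 + (n - k) = n.+3)%N by lia.
Qed.

Lemma layers_split i m n L : (forall k, L k \in disc 4) -> (i < m)%N -> (m <= n)%N ->
  eqv d n.+2 n.+3 (draw [:: (Split, i)] * layers (fun k => L k.-1) i.+2 m.+1)
                  (layers L i.+1 m * draw [:: (Split, i)]).
Proof.
move=> L4 + mn; have sp : strands n.+2 n.+3 [:: (Split, i)] -> True by [].
elim: m mn => [|m IHm] // mn im.
have [E|im'] := eqVneq i m.
  subst i; rewrite -> !layers0, drawing_mulr1, drawing_mul1r; apply: eqv_refl.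
  by rewrite strip_drawE; strands.
have {}im : (i < m)%N by lia.
rewrite -> (@layers_recr L i.+1 m im).
rewrite -> (@layers_recr (fun k => L k.-1) i.+2 m.+1 (im : (i.+2 <= m.+1)%N)), mulrA.
apply: (@eqv_trans _ _ (layers L i.+1 m * draw [:: (Split, i)] * insert m.+1 (L m))).
  apply: eqv_mul (IHm _ im) _; first by lia.
  apply: eqv_refl; have -> : n.+3 = (m.+1 + (2 + (n - m)))%N by lia.
  exact: insert_strip.
apply: (@eqv_swap n.+2); first by apply: layers_strip => //; lia.
rewrite [insert m.+1 (L m)]insertE [insert m (L m)]insertE.
by apply: split_below => //; exact: insert0_strip.
Qed.

(** The local form of scale invariance for the tensors [X0] and [X1] of two
   sibling leaves and the tensor [X] of their parent. *)
Definition fuses X0 X1 X :=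
  eqv d 2 3 (draw [:: (Split, 1%N)] * insert 0 X0 * shift 1 (insert 0 X1))
            (insert 0 X * draw [:: (Split, 0%N)]).

Lemma layers_cat L m n k : (m <= k)%N -> (k <= n)%N ->
  layers L m n = layers L m k * layers L k n.
Proof. by move=> mk kn; rewrite /layers (big_cat_nat mk kn). Qed.

Lemma layers_eq L L' m n : (forall k, (m <= k < n)%N -> L k = L' k) ->
  layers L m n = layers L' m n.
Proof. by move=> LL; apply: eq_big_nat => k kmn; rewrite LL. Qed.

(** The vertex moves up through the layers on its left, where it sits one place
   further to the right because of the horizontal strand, passes through the two
   layers of the new leaves as one layer, and then through the layers on its
   right, which thereby lose one place. *)
Lemma split_around i n L L' : (i < n)%N ->
  (forall k, L k \in disc 4) -> (forall k, L' k \in disc 4) ->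
  (forall k, (k < i)%N -> L' k = L k) -> (forall k, (i < k)%N -> L' k.+1 = L k) ->
  fuses (L' i) (L' i.+1) (L i) ->
  eqv d n.+2 n.+1
    (draw [:: (Split, i.+1)] * layers L' 0 n.+1 * draw [:: (Cap, n.+1)])
    (layers L 0 n * draw [:: (Cap, n)] * draw [:: (Split, i)]).
Proof.
move=> i_n L4 L'4 Llt Lgt fi.
have ES : layers L' 0 n.+1 = layers L 0 i * (insert i (L' i) * insert i.+1 (L' i.+1))
    * layers (fun k => L k.-1) i.+2 n.+1.
  rewrite -> (layers_cat L' (leq0n i.+2) (i_n : (i.+2 <= n.+1)%N)).
  rewrite -> (layers_recr L' (leq0n i.+1)), (layers_recr L' (leq0n i)).
  have -> : layers L' 0 i = layers L 0 i by apply: layers_eq => k /andP[_ /Llt].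
  have -> : layers L' i.+2 n.+1 = layers (fun k => L k.-1) i.+2 n.+1.
    by apply: layers_eq => -[|k] // /andP[ik _]; exact: Lgt.
  have assoc (a b e f : @drawing C) : a * b * e * f = a * (b * e) * f by rewrite -> !mulrA.
  exact: assoc.
have EL : layers L 0 n = layers L 0 i * insert i (L i) * layers L i.+1 n.
  apply: etrans (layers_cat L (leq0n i.+1) i_n) _.
  exact: (congr1 (fun t => t * layers L i.+1 n) (layers_recr L (leq0n i))).
have sp1 : draw [:: (Split, i.+1)] \in @strip C n.+2 n.+3 by rewrite strip_drawE; strands.
have sp0 : draw [:: (Split, i)] \in @strip C n.+2 n.+3 by rewrite strip_drawE; strands.
have lo m : (m < i.+1)%N -> layers L 0 m \in strip n.+2 n.+2.
  by move=> mi; apply: layers_strip => //; lia.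
have lo3 : layers (fun k => L k.-1) i.+2 n.+1 \in strip n.+3 n.+3.
  by apply: layers_strip.
have in0 z : z \in disc 4 -> insert i z \in strip n.+2 n.+2.
  move=> z4; have -> : n.+2 = (i + (2 + (n - i)))%N by lia.
  exact: insert_strip.
have step2 : eqv d n.+2 n.+3
    (draw [:: (Split, i.+1)] * (insert i (L' i) * insert i.+1 (L' i.+1)))
    (insert i (L i) * draw [:: (Split, i)]).
  rewrite [insert i (L' i)]insertE [insert i.+1 _]insertE [insert i (L i)]insertE.
  move: fi; rewrite /fuses.
  move: (insert 0 (L' i)) (insert 0 (L' i.+1)) (insert 0 (L i)) => x y z fi.
  have := eqv_shift i (n - i) fi.
  rewrite -> !shiftM, !shift_draw, shiftD; rewrite /shift_word /= /shift_piece /=.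
  rewrite addn0 addn1; rewrite -> mulrA.
  have -> : (i + (2 + (n - i)) = n.+2)%N by lia.
  by have -> : (i + (3 + (n - i)) = n.+3)%N by lia.
rewrite -> ES, EL.
apply: (@eqv_trans _ _ (layers L 0 i * insert i (L i) * layers L i.+1 n
   * draw [:: (Split, i)] * draw [:: (Cap, n.+1)])).
  apply: (@eqv_drawr _ _ _ n.+3); last by strands.
  apply: (@eqv_trans _ _ (layers L 0 i * insert i (L i) * draw [:: (Split, i)]
     * layers (fun k => L k.-1) i.+2 n.+1)).
    rewrite -> mulrA; apply: (@eqv_mul _ _ _ n.+3); last exact: eqv_refl.
    rewrite -> mulrA.
    apply: (@eqv_trans _ _ (layers L 0 i * draw [:: (Split, i.+1)]
        * (insert i (L' i) * insert i.+1 (L' i.+1)))).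
      apply: (@eqv_mul _ _ _ n.+3); first by apply: split_layers => //; lia.
      apply: eqv_refl; apply: (@stripM _ _ n.+3).
        have -> : n.+3 = (i + (2 + (n.+1 - i)))%N by lia.
        exact: insert_strip.
      have -> : n.+3 = (i.+1 + (2 + (n - i)))%N by lia.
      exact: insert_strip.
    by apply: (@eqv_swap n.+2) step2; exact: lo.
  apply: (@eqv_swap n.+2); last exact: layers_split.
  by apply: (@stripM _ _ n.+2); [exact: lo | exact: in0].
apply: (@eqv_swap n.+2).
  apply: (@stripM _ _ n.+2); last exact: layers_strip.
  by apply: (@stripM _ _ n.+2); [exact: lo | exact: in0].
have ps : strands n n.+1 [:: (Split, i)] by strands.
have := eqv_far d (strip_draw ps) (strip_draw (isT : strands 2 0 [:: (Cap, 0%N)])).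
rewrite -> !shift_draw; rewrite /shift_word /= /shift_piece /=.
by rewrite !addn0 !addn2.
Qed.

End Transfer.

(** * Transfer matrices on vectors *)

Section Operators.
Context {C : numClosedFieldType} (d : C).
Implicit Types (x y z : @drawing C) (u v w : seq piece).

Lemma insert_tensor p q r : eqv d 2 2 (insert 0 (tensor p q r)) (operator p q r).
Proof.
rewrite /insert shift0 /tensor; rewrite -> comb_drawr.
apply: eqv_comb; first exact: turn_H.
by apply: eqv_comb; [exact: turn_I | apply: eqv_comb; [exact: turn_E | exact: eqv_comb0]].
Qed.

Lemma eqv_widen j m n x y : eqv d m n x y -> eqv d (m + j) (n + j) x y.
Proof. by move=> /(eqv_shift 0 j); rewrite -> !shift0. Qed.

Lemma eqv_under m k n x y s l c s' l' c' : x * y \in strip m k ->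
  eqv d k n (s' * l' * c') (l * c * s) ->
  eqv d m n (x * (y * s') * l' * c') (x * y * l * c * s).
Proof.
move=> xk sl; have e1 : x * (y * s') * l' * c' = (x * y) * (s' * l' * c').
  by rewrite -> !mulrA.
have e2 : x * y * l * c * s = (x * y) * (l * c * s) by rewrite -> !mulrA.
rewrite -> e1, e2; exact: (eqv_mul (eqv_refl d xk) sl).
Qed.

Lemma tensor_fuses p q r p0 q0 r0 p1 q1 r1 :
  intertwines d p q r p0 q0 r0 p1 q1 r1 ->
  fuses d (tensor p0 q0 r0) (tensor p1 q1 r1) (tensor p q r).
Proof.
move=> /operator_split pqr; rewrite /fuses.
have t0 := eqv_widen 1 (insert_tensor p0 q0 r0); have t1 := insert_tensor p1 q1 r1.
have t := insert_tensor p q r.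
apply: eqv_trans _ (eqv_trans pqr _).
  apply: (@eqv_mul _ _ _ 3); last exact: (eqv_shift 1 0 t1).
  by apply: (@eqv_drawl _ _ _ 3); first exact: t0.
by apply: eqv_sym; apply: (@eqv_drawr _ _ _ 2); first exact: t.
Qed.

Lemma represents_same n (X : Q d n) x : represents X x -> same d n (rep X) x.
Proof. by case=> xn Xx; split; [exact: rep_disc | exact: xn | exact: Xx]. Qed.

Lemma transfer_represents n (LL : nat -> Q d 4) l (xi : Q d n) x :
  (forall k, represents (LL k) (l k)) -> represents xi x ->
  represents (transfer (fun i : 'I_n => LL i) xi) (transfer_word n l x).
Proof.
move=> Ll xix; rewrite /transfer (transfer_drawingE n (fun k => rep (LL k))).
have [tn t'n tt] : same d n (transfer_word n (fun k => rep (LL k)) (rep xi))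
    (transfer_word n l x).
  by apply: transfer_word_same => [k|]; exact: represents_same.
by apply: (represents_negligible _ t'n tt); exact: represents_class.
Qed.

Lemma attach_represents m i (xi : Q d m) x : (i < m)%N -> represents xi x ->
  represents (attach m.+1 i xi) (x * draw [:: (Split, i)]).
Proof.
move=> im xix; have sp : strands m m.+1 [:: (Split, i)] by strands.
have [an a'n aa] := same_drawr (represents_same xix) sp.
by apply: (represents_negligible _ a'n aa); exact: represents_class.
Qed.

Lemma transfer_attach n n' (LL LL' : nat -> Q d 4) l l' i (xi : Q d n) :
  n' = n.+1 -> (i < n)%N ->
  (forall k, represents (LL k) (l k)) -> (forall k, represents (LL' k) (l' k)) ->
  (forall k, (k < i)%N -> l' k = l k) -> (forall k, (i < k)%N -> l' k.+1 = l k) ->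
  fuses d (l' i) (l' i.+1) (l i) ->
  transfer (fun k : 'I_n' => LL' k) (attach n' i xi)
  = attach n' i (transfer (fun k : 'I_n => LL k) xi).
Proof.
move=> -> i_n Ll Ll' lt gt fi; have xix := represents_rep xi.
apply: (represents_eq (transfer_represents Ll' (attach_represents i_n xix))
  (attach_represents i_n (transfer_represents Ll xix))).
apply: negligible_skein; apply: eqv_skein; rewrite /transfer_word.
have xn : rep xi \in disc n by exact: rep_disc.
move: (rep xi) xn => x xn; rewrite -> shiftM, shift_draw.
apply: (@eqv_under _ n.+2).
  apply: (@strip_mull _ _ 2) => //.
  have -> : n.+2 = (1 + (n + 1))%N by lia.
  exact: (strip_shift 1 1 xn).
have l4 k : l k \in disc 4 by case: (Ll k).
have l'4 k : l' k \in disc 4 by case: (Ll' k).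
exact: split_around.
Qed.

Lemma Q1_eq0 (xi : Q d 1) : xi = 0.
Proof.
apply: (represents_eq (represents_rep xi) (represents0 d 1)).
by apply: negligible_skein; rewrite subr0; apply: disc1_skein; exact: rep_disc.
Qed.

Lemma attach0 m n i : n = m.+1 -> (i < m)%N -> attach n i (0 : Q d m) = 0.
Proof.
move=> -> im; apply: (represents_eq (attach_represents im (represents0 d m)) (represents0 d m.+1)).
by rewrite -> drawing_mul0r; rewrite subrr; exact: negligible0.
Qed.

Lemma transfer0 n (LL : nat -> Q d 4) :
  transfer (fun i : 'I_n => LL i) (0 : Q d n) = 0.
Proof.
apply: (represents_eq (transfer_represents (fun k => represents_rep (LL k)) (represents0 d n))
  (represents0 d n)).
rewrite /transfer_word; rewrite -> shift_0, drawing_mulr0, !drawing_mul0r.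
by rewrite subrr; exact: negligible0.
Qed.

End Operators.

(** * Words of leaves *)

Lemma codes_branch t i : (i < leaves t)%N ->
  let w := nth [::] (codes t) i in
  codes (branch t i)
  = take i (codes t) ++ [:: rcons w false; rcons w true] ++ drop i.+1 (codes t).
Proof.
elim: t i => [|l IHl r IHr] i /=; first by case: i.
rewrite -(size_codes l) => it; case: ifP => il /=.
  rewrite IHl; last by rewrite -size_codes.
  rewrite nth_cat size_map il (nth_map [::]) // take_cat drop_cat size_map il.
  rewrite !map_cat map_take map_drop -!catA; congr (_ ++ _ :: _ :: _).
  case: ltnP => // li; have -> : i.+1 = size (codes l) by lia.
  by rewrite subnn drop0 drop_oversize ?size_map.
have li : (size (codes l) <= i)%N by rewrite leqNgt il.
rewrite IHr; last by lia.
rewrite nth_cat size_map il (nth_map [::]); last by rewrite (size_codes r); lia.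
rewrite take_cat drop_cat size_map il ifF; last by lia.
by rewrite !map_cat map_take map_drop -!catA subSn.
Qed.

Lemma nth_codes_branch t i k : (i < leaves t)%N ->
  let w := nth [::] (codes t) i in
  nth [::] (codes (branch t i)) k =
  if (k < i)%N then nth [::] (codes t) k
  else if k == i then rcons w false
  else if k == i.+1 then rcons w true
  else nth [::] (codes t) k.-1.
Proof.
move=> it /=; rewrite codes_branch // nth_cat size_take size_codes it.
case: ltnP => [ki|ik]; first by rewrite nth_take.
have [->|ki] := eqVneq k i; first by rewrite subnn.
have [->|ki1] := eqVneq k i.+1; first by rewrite subSnn.
have -> : (k - i = (k - i - 2).+2)%N by lia.
by rewrite /= nth_drop; congr nth; lia.
Qed.

(** * Spectral parameters *)

(* Up to sign, the denominators that [field] leaves are among the hypotheses. *)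
Ltac nonzero := match goal with |- is_true (?X != 0) => first [ assumption |
  match goal with h : is_true (?Y != 0) |- _ =>
    (have -> : X = - Y by ring); rewrite oppr_eq0; exact h end ] end.

Section Spectral.
Context {C : numClosedFieldType} (d omega : C).
Hypotheses (omega_neq0 : omega != 0) (omega2 : 1 + omega ^+ 2 != 0).
Hypothesis d_omega : d = omega + omega^-1 + 1.

Definition coefH (z : C) := - (((1 + omega ^+ 2) * (z + omega ^+ 2)) / (omega ^+ 2 * (z + 1))).
Definition coefE (z : C) := - (((omega - 1) * (z + omega ^+ 2)) / (omega * (omega * z - 1))).

(** The coefficient of I is 1 in both A(z) and A(- omega z).  Comparing the
   coefficients of [basis4], which on the side of A(z) comes from I alone, forces
   this scalar on the tensor of the right leaf. *)
Definition ratio (z : C) := omega * (z - omega) / (z - omega ^+ 3).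

Lemma generic_neq0 z (n : int) : generic_spectral omega z ->
  z - omega ^ n != 0 /\ z + omega ^ n != 0.
Proof. by move=> /(_ n)[zn zn']; rewrite subr_eq0 zn addr_eq0 zn'. Qed.

Lemma generic_step z (n : int) : generic_spectral omega z ->
  generic_spectral omega (- omega ^ n * z).
Proof.
move=> gz m; have on : omega ^ n != 0 by rewrite expfz_neq0.
have [z1 z2] := gz (m - n).
have e : omega ^ m = omega ^ n * omega ^ (m - n) by rewrite -expfzDr // addrC subrK.
rewrite e mulNr -mulrN; split.
  by rewrite (inj_eq (mulfI on)) eqr_oppLR.
by rewrite -[X in _ != X]mulrN (inj_eq (mulfI on)) (inj_eq oppr_inj).
Qed.

Lemma intertwines_spectral c z : generic_spectral omega z ->
  let z0 := - omega * z in let z1 := - omega^-1 * z in let k := ratio z in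
  intertwines d (c * coefH z) c (c * coefE z)
    (c * coefH z0) c (c * coefE z0) (k * coefH z1) k (k * coefE z1).
Proof.
move=> gz /=; have deltaE : delta d = omega / (1 + omega ^+ 2).
  rewrite /delta d_omega addrK; apply: (canLR (invrK)).
  rewrite invf_div; field; exact: omega_neq0.
have h0 : z + 1 != 0 by have [] := generic_neq0 0 gz.
have h1 : z - omega != 0 by have [] := generic_neq0 1 gz; rewrite expr1z.
have h3 : z - omega ^+ 3 != 0 by have [] := generic_neq0 3 gz.
have hm1 : omega * z - 1 != 0.
  have [+ _] := generic_neq0 (-1) gz; rewrite -(inj_eq (mulfI omega_neq0)).
  by rewrite mulr0 mulrBr exprN1 divff.
have hm2 : omega ^+ 2 * z + 1 != 0.
  have [_] := generic_neq0 (-2) gz; rewrite -(inj_eq (mulfI (expf_neq0 2 omega_neq0))).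
  by rewrite mulr0 mulrDr -exprnN divff // expf_neq0.
rewrite /intertwines deltaE /ratio /coefH /coefE; split; split.
all: try field; do ?[apply/andP; split]; try nonzero. 
Qed.

(** The pair of the scalar and of the spectral parameter of a tensor.  The scalar
   of a parent goes to its left child; the right child has a scalar of its own,
   because the local identity is bilinear in the two children. *)
Definition spectral_step (b : bool) (s : C * C) : C * C :=
  if b then (ratio s.2, - omega^-1 * s.2) else (s.1, - omega * s.2).

Definition spectral_state (w : seq bool) (z : C) : C * C :=
  foldl (fun s b => spectral_step b s) (1, z) w.

Definition exponent (w : seq bool) : int :=
  foldl (fun n (b : bool) => n + (if b then -1 else 1)) 0 w.

Lemma spectral_state_rcons w b z :
  spectral_state (rcons w b) z = spectral_step b (spectral_state w z).
Proof. exact: foldl_rcons. Qed.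

Lemma spectral_stateE w z :
  (spectral_state w z).2 = (-1) ^+ odd (size w) * omega ^ exponent w * z.
Proof.
elim/last_ind: w => [|w b IHw]; first by rewrite !mul1r.
rewrite spectral_state_rcons size_rcons /exponent foldl_rcons -/(exponent w).
rewrite expfzDr // /spectral_step.
have -> : (-1) ^+ odd (size w).+1 = - (-1) ^+ odd (size w) :> C.
  by rewrite /= -[~~ _]addTb signr_addb mulN1r.
by case: b => /=; rewrite IHw ?exprN1 ?expr1z; ring.
Qed.

Lemma generic_state w z : generic_spectral omega z ->
  generic_spectral omega (spectral_state w z).2.
Proof.
move=> gz; elim/last_ind: w => [|w b IHw]; first by [].
rewrite spectral_state_rcons /spectral_step; case: b => /=.
  by have := generic_step (-1) IHw; rewrite exprN1.
by have := generic_step 1 IHw; rewrite expr1z.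
Qed.

Lemma elt4_scale c a b e : elt4 d (c * a) (c * b) (c * e) = c *: elt4 d a b e.
Proof.
have dist (V : lmodType C) (x y z : V) :
    (c * a) *: x + (c * b) *: y + (c * e) *: z = c *: (a *: x + b *: y + e *: z).
  by rewrite !scalerDr !scalerA.
exact: dist.
Qed.

Section Family.
Variables z0 z1 : C.

Definition family_coefs (w : seq bool) : C * C * C :=
  if w is b :: w' then
    let s := spectral_state w' (if b then z1 else z0) in
    (s.1 * coefH s.2, s.1, s.1 * coefE s.2)
  else (0, 0, 0).

Definition family w : Q d 4 :=
  let c := family_coefs w in elt4 d c.1.1 c.1.2 c.2.

Definition family_tensor w : drawing :=
  let c := family_coefs w in tensor c.1.1 c.1.2 c.2.

Lemma family_represents w : represents (family w) (family_tensor w).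
Proof. exact: elt4_represents. Qed.

Lemma family_cons b w : let s := spectral_state w (if b then z1 else z0) in
  family (b :: w) = s.1 *: A d omega s.2.
Proof. by rewrite /= -elt4_scale mulr1. Qed.

Hypotheses (gz0 : generic_spectral omega z0) (gz1 : generic_spectral omega z1).

Lemma family_fuses w : w != [::] ->
  fuses d (family_tensor (rcons w false)) (family_tensor (rcons w true)) (family_tensor w).
Proof.
case: w => // b w _; rewrite !rcons_cons.
apply: tensor_fuses; rewrite /= !spectral_state_rcons.
by apply: intertwines_spectral; apply: generic_state; case: (b).
Qed.

Lemma codes_neq0 t i : t <> Leaf -> (i < leaves t)%N -> nth [::] (codes t) i != [::].
Proof.
case: t => // l r _ /=; rewrite -(size_codes l) => it; rewrite nth_cat size_map.
case: ltnP => il; first by rewrite (nth_map [::]).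
by rewrite (nth_map [::]) // (size_codes r); lia.
Qed.

Lemma TsysE (L : seq bool -> Q d 4) t : t <> Leaf ->
  Tsys L (t := t) = transfer (fun i : 'I_(leaves t) => L (nth [::] (codes t) i)).
Proof. by case: t. Qed.

Lemma branch_neq_Leaf t i : branch t i <> Leaf.
Proof. by case: t => //= l r; case: ifP. Qed.

Lemma Tsys_branch t i (xi : Hsys d t) : t <> Leaf -> (i < leaves t)%N ->
  Tsys family (attach (leaves (branch t i)) i xi : Hsys d (branch t i))
  = attach (leaves (branch t i)) i (Tsys family xi).
Proof.
move=> tL it; rewrite (TsysE _ (@branch_neq_Leaf t i)) (TsysE _ tL).
pose code t k := nth [::] (codes t) k.
have codeL k : (k < i)%N -> code (branch t i) k = code t k.
  by move=> ki; rewrite /code nth_codes_branch // ki.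
have codeR k : (i < k)%N -> code (branch t i) k.+1 = code t k.
  by move=> ik; rewrite /code nth_codes_branch // !ifF //; lia.
have code0 : code (branch t i) i = rcons (code t i) false.
  by rewrite /code nth_codes_branch // ltnn eqxx.
have code1 : code (branch t i) i.+1 = rcons (code t i) true.
  by rewrite /code nth_codes_branch // eqxx !ifF //; lia.
apply: (transfer_attach (LL := fun k => family (code t k))
  (LL' := fun k => family (code (branch t i) k))
  (l := fun k => family_tensor (code t k))
  (l' := fun k => family_tensor (code (branch t i) k)) xi (leaves_branch it) it).
- by move=> k; exact: family_represents.
- by move=> k; exact: family_represents.
- by move=> k ki; rewrite codeL.
- by move=> k ik; rewrite codeR.
by rewrite code0 code1; apply: family_fuses; exact: codes_neq0.
Qed.

Lemma Tsys0 (L : seq bool -> Q d 4) t : Tsys L (0 : Hsys d t) = 0.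
Proof.
case: t => [//|l r].
exact: (@transfer0 _ d (leaves (Node l r)) (fun k => L (nth [::] (codes (Node l r)) k))).
Qed.

Lemma direct_map0 s t (f : Hsys d s -> Hsys d t) : direct_map f -> f 0 = 0.
Proof.
elim=> {t f} [//|t f i _ -> it].
exact: (attach0 d (leaves_branch it) it).
Qed.

Lemma family_scale_invariant : scale_invariant family.
Proof.
move=> s t _ f st xi; have [sL|sL] : s = Leaf \/ s <> Leaf by case: (s); [left|right].
  (* The space of the one-leaf tree is [Q 1]. *)
  move: f st xi; rewrite {}sL => f st xi.
  by rewrite (Q1_eq0 (xi : Q d 1)) (Tsys0 _ Leaf) (direct_map0 st) Tsys0.
suff [_ ->] : t <> Leaf /\ forall xi, Tsys family (f xi) = f (Tsys family xi) by [].
elim: st {xi} => {t f} [//|t f i _ [tL IHf] it].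
split=> [|xi]; first exact: branch_neq_Leaf.
apply: etrans (Tsys_branch (f xi) tL it) _.
exact: (congr1 (attach (leaves (branch t i)) i) (IHf xi)).
Qed.

End Family.

Lemma scale_invariant_family :
  exists (kappa : seq bool -> C -> C) (eps : seq bool -> bool) (p : seq bool -> int),
  forall z0 z1 : C, generic_spectral omega z0 -> generic_spectral omega z1 ->
  exists L : seq bool -> Q d 4,
    [/\ scale_invariant L,
        L [:: false] = A d omega z0 /\ L [:: true] = A d omega z1,
        forall xi : Q d 2, Tsys L (t := Node Leaf Leaf) xi
          = transfer (fun i : 'I_2 => A d omega (if i == ord0 then z0 else z1)) xi
      & forall w : seq bool,
          L (false :: w) = kappa w z0 *: A d omega ((-1) ^+ eps w * omega ^ p w * z0)
          /\ L (true :: w) = kappa w z1 *: A d omega ((-1) ^+ eps w * omega ^ p w * z1)].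
Proof.
exists (fun w z => (spectral_state w z).1), (fun w => odd (size w)), exponent.
move=> z0 z1 gz0 gz1; exists (family z0 z1).
have L1 b : family z0 z1 [:: b] = A d omega (if b then z1 else z0).
  by rewrite family_cons scale1r.
split.
- exact: family_scale_invariant.
- by rewrite !L1.
- move=> xi /=; congr (transfer _ xi); apply/funext => i.
  by case: i => -[|[|//]] i2 /=; rewrite L1.
by move=> w; rewrite !family_cons !spectral_stateE.
Qed.

End Spectral.

(** In the discrete case [d = 1 + 2 cos (2 pi / n)], where [2 pi / n < pi / 2]. *)
Lemma allowed_neq1 (R : realType) (d : R) : allowed d -> d != 1.
Proof.
case=> [[n n6 ->]|d3]; last by rewrite gt_eqF // (lt_le_trans _ d3) // ltr1n.
have n0 : (0 : R) < n%:R by rewrite ltr0n; lia.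
have c2 : 0 < cos (pi / n%:R *+ 2 : R).
  apply: cos_gt0_pihalf; apply/andP; split.
    apply: (@lt_trans _ _ 0); first by rewrite oppr_lt0 divr_gt0 ?pi_gt0.
    by rewrite pmulrn_lgt0 // divr_gt0 ?pi_gt0.
  rewrite -mulr_natr mulrAC ltr_pdivrMr // -mulrA ltr_pM2l ?pi_gt0 //.
  rewrite mulrC ltr_pdivlMr //.
  by rewrite -natrM ltr_nat; lia.
move: c2; rewrite cos_mulr2n; apply: contraTneq => E.
set c := cos _ in E *.
have -> : c ^+ 2 *+ 2 - 1 = (4 * c ^+ 2 - 1 - 1) / 2 by field.
by rewrite E subrr mul0r ltxx.
Qed.

Import complex.
Local Open Scope complex_scope.

(** * Scale invariant transfer matrices *)

Theorem corollary2p25 (R : realType) (d : R) (omega : R[i])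
    (d_allowed : allowed d) (d_neq3 : d != 3) (omega_neq0 : omega != 0)
    (d_omega : d%:C = omega + omega^-1 + 1) :
  exists (kappa : seq bool -> R[i] -> R[i])
         (eps : seq bool -> bool) (p : seq bool -> int),
  forall z0 z1 : R[i],
    generic_spectral omega z0 -> generic_spectral omega z1 ->
  exists L : seq bool -> Q d%:C 4,
    [/\ scale_invariant L,
        L [:: false] = A d%:C omega z0 /\ L [:: true] = A d%:C omega z1,
        forall xi : Q d%:C 2,
          Tsys L (t := Node Leaf Leaf) xi
          = transfer (fun i : 'I_2 =>
              A d%:C omega (if i == ord0 then z0 else z1)) xi
      & forall w : seq bool,
          L (false :: w)
            = kappa w z0 *: A d%:C omega ((-1) ^+ eps w * omega ^ p w * z0)
          /\ L (true :: w)
            = kappa w z1 *: A d%:C omega ((-1) ^+ eps w * omega ^ p w * z1)].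
Proof.
apply: scale_invariant_family => //.
(* If [omega ^+ 2 = -1] then [omega + omega^-1 = 0] and [d = 1]. *)
apply: contraNneq (allowed_neq1 d_allowed) => o2.
have oV : omega^-1 = - omega.
  apply: (mulfI omega_neq0); rewrite divff // mulrN -expr2.
  by apply/eqP; rewrite eq_sym -subr_eq0 -opprD oppr_eq0 addrC o2.
have := d_omega; rewrite oV subrr add0r => /(congr1 (@complex.Re R)) /= ->.
exact: eqxx.
Qed.
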